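(* Let $(\gamma:\alpha):(\mathcal C:A)\to(\mathcal D:B)$ be a morphism of corings such that the induced map $\tilde\gamma:B\otimes_A\mathcal C\to\mathcal D$, $b\otimes c\mapsto b\gamma(c)$, is a split epimorphism in ${}^{\mathcal D}\mathbf M$. Suppose that $M$ is a principal right $\mathcal C$-comodule that is faithfully flat as a $k$-module, $\mathcal D$ is flat as a left $B$-module and $B\otimes_A\mathcal C$ is a coflat left $\mathcal D$-comodule. Then $M\otimes_A B$ is a principal right $\mathcal D$-comodule.
   Context: Algebras are associative unital algebras over a commutative unital ring $k$. An $A$-coring $\mathcal C$ is an $(A,A)$-bimodule with coassociative coproduct $\Delta_{\mathcal C}(c)=\sum c_{(1)}\otimes c_{(2)}\in\mathcal C\otimes_A\mathcal C$ and counit $\varepsilon_{\mathcal C}:\mathcal C\to A$ (bimodule maps). $\mathbf M^{\mathcal C}$ (resp. ${}^{\mathcal C}\mathbf M$) is the category of right (resp. left) $\mathcal C$-comodules; right coactions are written $\varrho^M(m)=\sum m_{(0)}\otimes m_{(1)}\in M\otimes_A\mathcal C$. $\mathrm{Hom}^{-\mathcal C}(M,N)$ denotes right colinear maps; $\mathrm{End}^{-\mathcal C}(M)$ is a ring under composition, $M$ is a left module over it and $\mathrm{Hom}^{-\mathcal C}(M,N)$ a right module via $fs=f\circ s$. $\mathcal D$ is a comodule over itself via $\Delta_{\mathcal D}$. A morphism of corings $(\gamma:\alpha):(\mathcal C:A)\to(\mathcal D:B)$, with $\mathcal C$ an $A$-coring and $\mathcal D$ a $B$-coring, consists of an algebra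 map $\alpha:A\to B$ and an $(A,A)$-bimodule map $\gamma:\mathcal C\to\mathcal D$ ($\mathcal D$ being an $(A,A)$-bimodule via $\alpha$) with $\chi\circ(\gamma\otimes_A\gamma)\circ\Delta_{\mathcal C}=\Delta_{\mathcal D}\circ\gamma$ and $\varepsilon_{\mathcal D}\circ\gamma=\alpha\circ\varepsilon_{\mathcal C}$, where $\chi:\mathcal D\otimes_A\mathcal D\to\mathcal D\otimes_B\mathcal D$ is the canonical map. For $M\in\mathbf M^{\mathcal C}$, $M\otimes_A B$ is a right $\mathcal D$-comodule via $m\otimes b\mapsto\sum m_{(0)}\otimes\gamma(m_{(1)})b\in M\otimes_A\mathcal D\simeq(M\otimes_A B)\otimes_B\mathcal D$. $B\otimes_A\mathcal C$ is a left $\mathcal D$-comodule via $b\otimes c\mapsto\sum b\gamma(c_{(1)})\otimes c_{(2)}\in\mathcal D\otimes_A\mathcal C\simeq\mathcal D\otimes_B(B\otimes_A\mathcal C)$. A right $\mathcal C$-comodule $M$ is Galois if it is finitely generated and projective as a right $A$-module and, with $S=\mathrm{End}^{-\mathcal C}(M)$, the map $\mathrm{Hom}^{-\mathcal C}(M,\mathcal C)\otimes_S M\to\mathcal C$, $f\otimes m\mapsto f(m)$, is an isomorphism of right $\mathcal C$-comodules. A Galois right comodule is principal if it is projective as a left module over its endomorphism ring $S$. The cotensor product $N\square_{\mathcal D}X$ is the kernel of $\varrho^N\otimes_B X-N\otimes_B{}^X\!\varrho:N\otimes_B X\to N\otimes_B\mathcal D\otimes_B X$. For $\mathcal D$ flat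 as a left $B$-module, a left $\mathcal D$-comodule $X$ is coflat if $-\square_{\mathcal D}X:\mathbf M^{\mathcal D}\to\mathbf M_k$ is exact. *)

(* Defs.v *)
From HB Require Import structures.
From mathcomp Require Import all_boot all_algebra.
From mathcomp Require Import boolp functions.

Set Implicit Arguments.
Unset Strict Implicit.
Unset Printing Implicit Defensive.

Import GRing.Theory.
Local Open Scope ring_scope.
Local Open Scope quotient_scope.

(* A right R-module is an lmodType over the converse ring R^c. *)
Definition ract (R : pzRingType) (M : lmodType R^c) (m : M) (r : R) : M :=
  (r : R^c) *: m.

Notation "m <* r" := (ract m r) (at level 40, left associativity) : ring_scope.

Section RightAction.
Variables (R : pzRingType) (M : lmodType R^c).
Implicit Types (m : M) (r : R).

Lemma ractA m r s : m <* r <* s = m <* (r * s).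
Proof. exact: scalerA. Qed.
Lemma ract1 m : m <* 1 = m. Proof. exact: scale1r. Qed.
Lemma ractDl m m' r : (m + m') <* r = m <* r + m' <* r.
Proof. exact: scalerDr. Qed.
Lemma ractDr m r s : m <* (r + s) = m <* r + m <* s.
Proof. exact: scalerDl. Qed.

End RightAction.

Section TensorProduct.
Variables (R : pzRingType) (M : lmodType R^c) (N : lmodType R).

(* Finite formal sums of pairs, modulo the relations of M (x)_R N; no formal
   opposites are needed, because -(m (x) n) is (-m) (x) n. *)
Inductive tensor_eq : seq (M * N) -> seq (M * N) -> Prop :=
| TensorRefl s : tensor_eq s s
| TensorSym s t : tensor_eq s t -> tensor_eq t s
| TensorTrans s t u : tensor_eq s t -> tensor_eq t u -> tensor_eq s u
| TensorCat s s' t t' :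
    tensor_eq s s' -> tensor_eq t t' -> tensor_eq (s ++ t) (s' ++ t')
| TensorComm s t : tensor_eq (s ++ t) (t ++ s)
| Tensor0 n : tensor_eq [:: (0, n)] [::]
| TensorDl m m' n : tensor_eq [:: (m + m', n)] [:: (m, n); (m', n)]
| TensorDr m n n' : tensor_eq [:: (m, n + n')] [:: (m, n); (m, n')]
| TensorZ m r n : tensor_eq [:: (m <* r, n)] [:: (m, r *: n)].

Definition tensor_eqb (s t : seq (M * N)) : bool := `[< tensor_eq s t >].

Lemma tensor_eqb_equiv : equiv_class_of tensor_eqb.
Proof.
split=> [s|s t|t s u]; first by apply/asboolP; exact: TensorRefl.
  by apply/asboolP/asboolP; exact: TensorSym.
by move=> /asboolP st /asboolP tu; apply/asboolP; exact: TensorTrans st tu.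
Qed.

Canonical tensor_eqb_equivRel := EquivRelPack tensor_eqb_equiv.
Canonical tensor_eqb_encModRel := defaultEncModRel tensor_eqb.

Definition tensor := {eq_quot tensor_eqb}.

HB.instance Definition _ := EqQuotient.on tensor.
HB.instance Definition _ := Choice.on tensor.

Let sum_of (x : tensor) : seq (M * N) := repr x.
Let cls (s : seq (M * N)) : tensor := \pi_tensor s.

Let clsP s t : cls s = cls t <-> tensor_eq s t.
Proof.
split=> [/eqmodP/asboolP // | st]; apply/eqmodP/asboolP; exact: st.
Qed.

Let clsK x : cls (sum_of x) = x. Proof. exact: reprK. Qed.

Let sum_cls s : tensor_eq (sum_of (cls s)) s.
Proof. by apply/clsP; rewrite clsK. Qed.

Let tadd (x y : tensor) : tensor := cls (sum_of x ++ sum_of y).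
Let topp (x : tensor) : tensor := cls [seq (- p.1, p.2) | p <- sum_of x].

Let tadd_cls s t : tadd (cls s) (cls t) = cls (s ++ t).
Proof. by apply/clsP/TensorCat; exact: sum_cls. Qed.

Let taddA : associative tadd.
Proof.
by move=> x y z; rewrite -(clsK x) -(clsK y) -(clsK z) !tadd_cls catA.
Qed.

Let taddC : commutative tadd.
Proof. by move=> x y; apply/clsP; exact: TensorComm. Qed.

Let tadd0 : left_id (cls [::]) tadd.
Proof. by move=> x; rewrite -(clsK x) tadd_cls. Qed.

Let taddN : left_inverse (cls [::]) topp tadd.
Proof.
move=> x; rewrite -{2}(clsK x) tadd_cls; apply/clsP.
elim: (sum_of x) => [|[m n] s IHs] /=; first exact: TensorRefl.
set s' := map _ s in IHs *.
have mn0 : tensor_eq [:: (- m, n); (m, n)] [::].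
  apply: TensorTrans (TensorSym (TensorDl _ _ _)) _.
  by rewrite addNr; exact: Tensor0.
apply: (TensorTrans _ (TensorCat mn0 IHs)).
apply: (@TensorCat [:: (- m, n)] [:: (- m, n)] (s' ++ (m, n) :: s)
         ((m, n) :: s' ++ s)); first exact: TensorRefl.
rewrite -cat1s catA -cat_cons -cat1s; apply: TensorCat; last exact: TensorRefl.
exact: TensorComm.
Qed.

HB.instance Definition _ :=
  GRing.isZmodule.Build tensor taddA taddC tadd0 taddN.

Definition tpure (m : M) (n : N) : tensor := cls [:: (m, n)].

Let cls_cons p s : cls (p :: s) = tpure p.1 p.2 + cls s.
Proof. by rewrite /tpure [RHS]tadd_cls; case: p. Qed.

Let cls_sum s : cls s = \sum_(p <- s) tpure p.1 p.2.
Proof.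
elim: s => [|p s IHs]; first by rewrite big_nil.
by rewrite big_cons cls_cons IHs.
Qed.

Lemma tpureDl m m' n : tpure (m + m') n = tpure m n + tpure m' n.
Proof.
rewrite [LHS]/tpure; have /clsP -> := TensorDl m m' n.
by rewrite cls_sum !big_cons big_nil addr0.
Qed.

Lemma tpureDr m n n' : tpure m (n + n') = tpure m n + tpure m n'.
Proof.
rewrite [LHS]/tpure; have /clsP -> := TensorDr m n n'.
by rewrite cls_sum !big_cons big_nil addr0.
Qed.

Lemma tpureZ m r n : tpure (m <* r) n = tpure m (r *: n).
Proof. by apply/clsP; exact: TensorZ. Qed.

Lemma tensor_sum x : exists s, x = \sum_(p <- s) tpure p.1 p.2.
Proof. by exists (sum_of x); rewrite -cls_sum clsK. Qed.

Lemma tensor_ind (P : tensor -> Prop) :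
    (forall m n, P (tpure m n)) -> (forall x y, P x -> P y -> P (x + y)) ->
  forall x, P x.
Proof.
move=> Pp PD x; have [s ->] := tensor_sum x.
have P0 : P 0.
  have -> : 0 = tpure 0 0 by apply: (addrI (tpure 0 0)); rewrite -tpureDl !addr0.
  exact: Pp.
by elim: s => [|p s IHs]; rewrite ?big_nil // big_cons; exact: PD.
Qed.

Definition balanced (G : zmodType) (f : M -> N -> G) : Prop :=
  [/\ forall m m' n, f (m + m') n = f m n + f m' n,
      forall m n n', f m (n + n') = f m n + f m n' &
      forall m r n, f (m <* r) n = f m (r *: n)].

(* The map M (x)_R N -> G induced by a balanced map f; when f is not balanced
   the value is meaningless, since it depends on the representative. *)
Definition tlift (G : zmodType) (f : M -> N -> G) (x : tensor) : G :=
  \sum_(p <- repr x) f p.1 p.2.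

Section Lift.
Variables (G : zmodType) (f : M -> N -> G).
Hypothesis fb : balanced f.

Let tlift_cls s : tlift f (cls s) = \sum_(p <- s) f p.1 p.2.
Proof.
have [fDl fDr fZ] := fb; rewrite /tlift.
suff eq_sum u v : tensor_eq u v ->
    \sum_(p <- u) f p.1 p.2 = \sum_(p <- v) f p.1 p.2 by exact/eq_sum/sum_cls.
elim=> {u v}; first by [].
- by move=> ? ? _ ->.
- by move=> ? ? ? _ -> _ ->.
- by move=> ? ? ? ? _ + _; rewrite !big_cat /= => -> ->.
- by move=> s1 t1; rewrite !big_cat /= addrC.
- move=> n; rewrite big_seq1 big_nil /=.
  by apply: (addrI (f 0 n)); rewrite -fDl !addr0.
- by move=> m m' n; rewrite !big_cons !big_nil /= fDl !addr0.
- by move=> m n n'; rewrite !big_cons !big_nil /= fDr !addr0.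
- by move=> m r n; rewrite !big_seq1 /= fZ.
Qed.

Lemma tlift_pure m n : tlift f (tpure m n) = f m n.
Proof. by rewrite tlift_cls big_seq1. Qed.

Lemma tliftD x y : tlift f (x + y) = tlift f x + tlift f y.
Proof. by rewrite [x + y]/(cls _) tlift_cls big_cat. Qed.

End Lift.

End TensorProduct.

Arguments tpure {R} M N m n.

Section Linear.
Variables (R : pzRingType) (U V : lmodType R) (f : U -> V).
Hypothesis fl : linear f.

Lemma linD u v : f (u + v) = f u + f v.
Proof. by have := fl 1 u v; rewrite !scale1r. Qed.

Lemma lin0 : f 0 = 0.
Proof. by apply: (addrI (f 0)); rewrite -linD !addr0. Qed.

Lemma linZ r u : f (r *: u) = r *: f u.
Proof. by have := fl r u 0; rewrite lin0 !addr0. Qed.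

End Linear.

Lemma linR (R : pzRingType) (U V : lmodType R^c) (f : U -> V) :
  linear f -> forall u (r : R), f (u <* r) = f u <* r.
Proof. by move=> fl u r; exact: (linZ fl (r : R^c)). Qed.

Lemma tensor_ext (R : pzRingType) (M : lmodType R^c) (N : lmodType R)
    (G : zmodType) (f g : tensor M N -> G) :
    {morph f : x y / x + y} -> {morph g : x y / x + y} ->
    (forall m n, f (tpure M N m n) = g (tpure M N m n)) ->
  f =1 g.
Proof. by move=> fD gD fg; elim/tensor_ind => // x y; rewrite fD gD => -> ->. Qed.

Record bimod (R T : pzRingType) := Bimod {
  blmod :> lmodType R;
  bract : blmod -> T -> blmod;
  bractA : forall v s t, bract (bract v s) t = bract v (s * t);
  bract1 : forall v, bract v 1 = v;
  bractDl : forall v w t, bract (v + w) t = bract v t + bract w t;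
  bractDr : forall v s t, bract v (s + t) = bract v s + bract v t;
  bractZ : forall r v t, bract (r *: v) t = r *: bract v t
}.

Definition bimod_map (R T : pzRingType) (V W : bimod R T) (f : V -> W) : Prop :=
  linear f /\ forall v t, f (bract v t) = bract (f v) t.

Definition action_carrier (R : pzRingType) (V : zmodType) (act : R -> V -> V) :
  Type := V.

Section ModuleOfAction.
Variables (R : pzRingType) (V : zmodType) (act : R -> V -> V).
Hypotheses (actA : forall r s v, act r (act s v) = act (r * s) v)
  (act1 : left_id 1 act) (actDr : right_distributive act +%R)
  (actDl : forall v, {morph act^~ v : r s / r + s}).

Local Notation carrier := (action_carrier act).
HB.instance Definition _ := GRing.Zmodule.on carrier.
HB.instance Definition _ :=
  GRing.Zmodule_isLmodule.Build R carrier actA act1 actDr actDl.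

Definition lmodule_of_action : lmodType R := carrier.

End ModuleOfAction.

Section UnderlyingRightModule.
Variables (R T : pzRingType) (V : bimod R T).

Let act (t : T^c) (v : V) : V := bract v t.

Let actA s t v : act s (act t v) = act (s * t) v. Proof. exact: bractA. Qed.
Let act1 : left_id 1 act. Proof. exact: bract1. Qed.
Let actDr : right_distributive act +%R.
Proof. by move=> t v w; exact: bractDl. Qed.
Let actDl v : {morph act^~ v : s t / s + t}.
Proof. by move=> s t; exact: bractDr. Qed.

Definition rmod : lmodType T^c :=
  lmodule_of_action actA act1 actDr actDl.

End UnderlyingRightModule.

Section RestrictionOfScalars.
Variables (R T : pzRingType) (f : {rmorphism R -> T}).

Section Module.
Variable V : lmodType T.

Let act (r : R) (v : V) : V := f r *: v.
Let actA r s v : act r (act s v) = act (r * s) v.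
Proof. by rewrite /act scalerA rmorphM. Qed.
Let act1 : left_id 1 act. Proof. by move=> v; rewrite /act rmorph1 scale1r. Qed.
Let actDr : right_distributive act +%R. Proof. by move=> r; exact: scalerDr. Qed.
Let actDl v : {morph act^~ v : r s / r + s}.
Proof. by move=> r s; rewrite /act rmorphD scalerDl. Qed.

Definition restr : lmodType R :=
  lmodule_of_action actA act1 actDr actDl.

End Module.

Definition lrestr (Q : pzRingType) (V : bimod T Q) : bimod R Q :=
  @Bimod R Q (restr V) (@bract _ _ V) (@bractA _ _ V) (@bract1 _ _ V)
    (@bractDl _ _ V) (@bractDr _ _ V) (fun r => bractZ (f r)).

Section Right.
Variables (Q : pzRingType) (V : bimod Q T).

Let act (v : V) (r : R) : V := bract v (f r).
Let actA v r s : act (act v r) s = act v (r * s).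
Proof. by rewrite /act bractA rmorphM. Qed.
Let act1 v : act v 1 = v. Proof. by rewrite /act rmorph1 bract1. Qed.
Let actDr v r s : act v (r + s) = act v r + act v s.
Proof. by rewrite /act rmorphD bractDr. Qed.

Definition rrestr : bimod Q R :=
  @Bimod Q R V act actA act1 (fun v w r => bractDl v w (f r)) actDr
    (fun q v r => bractZ q v (f r)).

End Right.

Definition birestr (V : bimod T T) : bimod R R := lrestr (rrestr V).

End RestrictionOfScalars.

Definition regular (R : pzRingType) : bimod R R :=
  @Bimod R R R^o (fun v r => (v : R) * r) (fun v s t => esym (mulrA _ _ _))
    (@mulr1 R) (@mulrDl R) (@mulrDr R) (fun r v t => esym (mulrA _ _ _)).

Section TensorRight.
Variables (R T : pzRingType) (M : lmodType R^c) (N : bimod R T).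

Let act (t : T^c) : tensor M N -> tensor M N :=
  tlift (fun m n => tpure M N m (@bract R T N n t)).

Let act_balanced (t : T) : balanced (fun m (n : N) => tpure M N m (bract n t)).
Proof.
split=> *; first exact: tpureDl; first by rewrite bractDl tpureDr.
by rewrite tpureZ bractZ.
Qed.

Let act_pure t m n : act t (tpure M N m n) = tpure M N m (@bract R T N n t).
Proof. exact: tlift_pure (act_balanced t) _ _. Qed.

Let actDr : right_distributive act +%R.
Proof. by move=> t x y; exact: tliftD (act_balanced t) _ _. Qed.

Let actA s t x : act s (act t x) = act (s * t) x.
Proof.
elim/tensor_ind: x => [m n|x y IHx IHy]; first by rewrite !act_pure bractA.
by rewrite !actDr IHx IHy.
Qed.

Let act1 : left_id 1 act.
Proof.
elim/tensor_ind => [m n|x y IHx IHy]; first by rewrite act_pure bract1.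
by rewrite actDr IHx IHy.
Qed.

Let actDl x : {morph act^~ x : s t / s + t}.
Proof.
move=> s t; elim/tensor_ind: x => [m n|x y IHx IHy].
  by rewrite !act_pure bractDr tpureDr.
by rewrite !actDr IHx IHy addrACA.
Qed.

Definition rtensor : lmodType T^c :=
  lmodule_of_action actA act1 actDr actDl.

Lemma rtensor_pure m n (t : T) :
  (tpure M N m n : rtensor) <* t = tpure M N m (bract n t).
Proof. exact: act_pure. Qed.

Lemma rtensor_linear (W : lmodType T^c) (f : rtensor -> W) :
    {morph f : x y / (x + y : tensor M N) >-> x + y} ->
    (forall m n t, f (tpure M N m (bract n t)) = f (tpure M N m n) <* t) ->
  linear f.
Proof.
move=> fD fp a x y; rewrite fD; congr (_ + _).
elim/tensor_ind: x => [m n|u v IHu IHv].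
  by rewrite -[RHS]/(ract (R := T) _ a) -fp -rtensor_pure.
rewrite fD [RHS]scalerDr -IHu -IHv -fD.
by congr f; exact: (@scalerDr _ rtensor a u v).
Qed.

End TensorRight.

Section TensorLeft.
Variables (R T : pzRingType) (M : bimod R T) (N : lmodType T).

Local Notation MN := (tensor (rmod M) N).

Let act (r : R) : MN -> MN :=
  tlift (fun (m : rmod M) n => tpure (rmod M) N (r *: (m : M)) n).

Let act_balanced (r : R) :
  balanced (fun (m : rmod M) (n : N) => tpure (rmod M) N (r *: (m : M)) n).
Proof.
split=> [m m' n|m n n'|m t n]; last 1 first.
- by rewrite -tpureZ; congr tpure; symmetry; exact: bractZ.
- by rewrite -tpureDl; congr tpure; exact: (@scalerDr R M).
- exact: tpureDr.
Qed.

Let act_pure r m n :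
  act r (tpure (rmod M) N m n) = tpure (rmod M) N (r *: (m : M)) n.
Proof. exact: tlift_pure (act_balanced r) _ _. Qed.

Let actDr : right_distributive act +%R.
Proof. by move=> t x y; exact: tliftD (act_balanced t) _ _. Qed.

Let actA s t x : act s (act t x) = act (s * t) x.
Proof.
elim/tensor_ind: x => [m n|x y IHx IHy]; first by rewrite !act_pure scalerA.
by rewrite !actDr IHx IHy.
Qed.

Let act1 : left_id 1 act.
Proof.
elim/tensor_ind => [m n|x y IHx IHy]; first by rewrite act_pure scale1r.
by rewrite actDr IHx IHy.
Qed.

Let actDl x : {morph act^~ x : s t / s + t}.
Proof.
move=> s t; elim/tensor_ind: x => [m n|x y IHx IHy].
  by rewrite !act_pure scalerDl -tpureDl.
by rewrite !actDr IHx IHy addrACA.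
Qed.

Definition ltensor : lmodType R :=
  lmodule_of_action actA act1 actDr actDl.

Lemma ltensor_pure r m n :
  r *: (tpure (rmod M) N m n : ltensor) = tpure (rmod M) N (r *: (m : M)) n.
Proof. exact: act_pure. Qed.

Lemma ltensor_linear (W : lmodType R) (f : ltensor -> W) :
    {morph f : x y / (x + y : MN) >-> x + y} ->
    (forall r m n, f (tpure (rmod M) N (r *: (m : M)) n)
       = r *: f (tpure (rmod M) N m n)) ->
  linear f.
Proof.
move=> fD fp a x y; rewrite fD; congr (_ + _).
elim/tensor_ind: x => [m n|u v IHu IHv]; first by rewrite -fp -ltensor_pure.
rewrite fD [RHS]scalerDr -IHu -IHv -fD.
by congr f; exact: (@scalerDr R ltensor a u v).
Qed.

End TensorLeft.

Section TensorBimodule.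
Variables (R T Q : pzRingType) (M : bimod R T) (N : bimod T Q).

Let act (x : ltensor M N) (q : Q) : ltensor M N := (x : rtensor (rmod M) N) <* q.

Let actZ r x q : act (r *: x) q = r *: act x q.
Proof.
have actD u v t : act (u + v) t = act u t + act v t.
  exact: (@ractDl Q (rtensor (rmod M) N)).
elim/tensor_ind: x => [m n|x y IHx IHy].
  by rewrite /act ltensor_pure !rtensor_pure ltensor_pure.
by rewrite (scalerDr r (x : ltensor M N)) !actD IHx IHy -scalerDr.
Qed.

Definition btensor : bimod R Q :=
  @Bimod R Q (ltensor M N) act
    (@ractA Q (rtensor (rmod M) N)) (@ract1 Q (rtensor (rmod M) N))
    (@ractDl Q (rtensor (rmod M) N)) (@ractDr Q (rtensor (rmod M) N)) actZ.

End TensorBimodule.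

(* f (x) g; meaningful when f and g are linear. *)
Definition tmap (R : pzRingType) (M M' : lmodType R^c) (N N' : lmodType R)
    (f : M -> M') (g : N -> N') : tensor M N -> tensor M' N' :=
  tlift (fun m n => tpure M' N' (f m) (g n)).

Section TensorMap.
Variables (R : pzRingType) (M M' : lmodType R^c) (N N' : lmodType R).
Variables (f : M -> M') (g : N -> N').
Hypotheses (fl : linear f) (gl : linear g).

Lemma tmap_balanced : balanced (fun m n => tpure M' N' (f m) (g n)).
Proof.
split=> *; first by rewrite (linD fl) tpureDl.
  by rewrite (linD gl) tpureDr.
by rewrite (linR fl) (linZ gl) tpureZ.
Qed.

Lemma tmap_pure m n : tmap f g (tpure M N m n) = tpure M' N' (f m) (g n).
Proof. exact: tlift_pure tmap_balanced _ _. Qed.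

Lemma tmapD : {morph tmap f g : x y / x + y}.
Proof. exact: tliftD tmap_balanced. Qed.

End TensorMap.

Lemma tmap_rlinear (R T : pzRingType) (M M' : lmodType R^c) (N N' : bimod R T)
    (f : M -> M') (g : N -> N') :
  linear f -> bimod_map g -> linear (tmap f g : rtensor M N -> rtensor M' N').
Proof.
move=> fl [gl gr]; apply: rtensor_linear => [x y|m n t]; first exact: tmapD.
by rewrite !tmap_pure // rtensor_pure gr.
Qed.

Lemma tmap_llinear (R T : pzRingType) (M M' : bimod R T) (N N' : lmodType T)
    (f : M -> M') (g : N -> N') :
  bimod_map f -> linear g ->
  linear (tmap (M := rmod M) (M' := rmod M') f g : ltensor M N -> ltensor M' N').
Proof.
move=> [fl fr] gl; have fl' : linear (f : rmod M -> rmod M').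
  move=> a u v; rewrite (linD fl); congr (_ + _).
  exact: (fr u a).
apply: ltensor_linear => [x y|r m n]; first exact: tmapD.
by rewrite !tmap_pure // ltensor_pure (linZ fl).
Qed.

Section Associator.
Variables (R T : pzRingType).
Variables (M : lmodType R^c) (N : bimod R T) (P : lmodType T).

Local Notation pureR m y := (tpure M (ltensor N P) m y).

Let inner (p : P) (m : M) (n : N) : tensor M (ltensor N P) :=
  pureR m (tpure (rmod N) P n p).

Let inner_balanced p : balanced (inner p).
Proof.
split=> [m m' n|m n n'|m r n]; rewrite /inner; first exact: tpureDl.
  by rewrite -tpureDr; congr tpure; exact: tpureDl.
by rewrite tpureZ ltensor_pure.
Qed.

(* (m (x) n) (x) p |-> m (x) (n (x) p) *)
Definition tassoc : tensor (rtensor M N) P -> tensor M (ltensor N P) :=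
  tlift (fun (x : rtensor M N) p => tlift (inner p) x).

Let outer_balanced : balanced (fun (x : rtensor M N) p => tlift (inner p) x).
Proof.
split=> [x y p|x p p'|x t p]; first exact: tliftD (inner_balanced p) _ _.
- elim/tensor_ind: x => [m n|x y IHx IHy].
    rewrite !(tlift_pure (inner_balanced _)) /inner -tpureDr; congr tpure.
    exact: tpureDr.
  by rewrite !(tliftD (inner_balanced _)) IHx IHy addrACA.
- elim/tensor_ind: x => [m n|x y IHx IHy].
    rewrite rtensor_pure !(tlift_pure (inner_balanced _)) /inner; congr tpure.
    exact: (tpureZ (M := rmod N)).
  rewrite (ractDl (M := rtensor M N)) !(tliftD (inner_balanced _)).
  by rewrite IHx IHy.
Qed.

Lemma tassoc_pure m n p :
  tassoc (tpure (rtensor M N) P (tpure M N m n) p)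
    = tpure M (ltensor N P) m (tpure (rmod N) P n p).
Proof.
by rewrite /tassoc (tlift_pure outer_balanced) (tlift_pure (inner_balanced _)).
Qed.

Lemma tassocD : {morph tassoc : x y / x + y}.
Proof. exact: tliftD outer_balanced. Qed.

End Associator.

Arguments tassoc {R T} M N P x.

(* Not algType, which requires the algebra to be a nonzero ring. *)
Record kalgebra (k : comPzRingType) := KAlgebra {
  kring :> pzRingType;
  kunit : {rmorphism k -> kring};
  kcentral : forall x a, kunit x * a = a * kunit x
}.

Record coring (k : comPzRingType) (A : kalgebra k) := Coring {
  cbimod :> bimod A A;
  (* bimodules over k-algebras have equal left and right k-actions *)
  ccentral : forall (x : k) (c : cbimod), kunit A x *: c = bract c (kunit A x);
  delta : cbimod -> btensor cbimod cbimod;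
  delta_bimod_map : bimod_map delta;
  eps : cbimod -> regular A;
  eps_bimod_map : bimod_map eps;
  delta_coassoc : forall c,
    tassoc (rmod cbimod) cbimod cbimod
        (tmap (M := rmod cbimod) (M' := rtensor (rmod cbimod) cbimod)
              delta id (delta c))
      = tmap (N' := ltensor cbimod cbimod) id delta (delta c);
  delta_counitl : forall c,
    tlift (fun (c1 : rmod cbimod) (c2 : cbimod) => (eps c1 : A) *: c2) (delta c)
      = c;
  delta_counitr : forall c,
    tlift (fun (c1 : rmod cbimod) (c2 : cbimod) => c1 <* (eps c2 : A)) (delta c)
      = c
}.

Section Comodules.
Variables (k : comPzRingType) (A : kalgebra k) (C : coring A).

Record rcomod := RComod {
  rcmod :> lmodType A^c;
  rcoact : rcmod -> rtensor rcmod C;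
  rcoact_linear : linear rcoact;
  rcoact_coassoc : forall m,
    tassoc rcmod C C (tmap (N := C) rcoact id (rcoact m))
      = tmap (N' := ltensor C C) id (@delta _ _ C) (rcoact m);
  rcoact_counit : forall m,
    tlift (fun (m0 : rcmod) (m1 : C) => m0 <* (eps m1 : A)) (rcoact m) = m
}.

Record lcomod := LComod {
  lcmod :> lmodType A;
  lcoact : lcmod -> ltensor C lcmod;
  lcoact_linear : linear lcoact;
  lcoact_coassoc : forall x,
    tassoc (rmod C) C lcmod
        (tmap (M := rmod C) (M' := rtensor (rmod C) C)
              (@delta _ _ C) id (lcoact x))
      = tmap (M := rmod C) id lcoact (lcoact x);
  lcoact_counit : forall x,
    tlift (fun (x1 : rmod C) (x0 : lcmod) => (eps x1 : A) *: x0) (lcoact x) = x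
}.

Definition rcolinear (M N : rcomod) (f : M -> N) : Prop :=
  linear f /\ forall m, rcoact (f m) = tmap (N := C) f id (rcoact m).

Definition lcolinear (X Y : lcomod) (f : X -> Y) : Prop :=
  linear f /\ forall x, lcoact (f x) = tmap (M := rmod C) id f (lcoact x).

Lemma delta_rlinear :
  linear (@delta _ _ C : rmod C -> rtensor (rmod C) C).
Proof.
move=> a u v; rewrite -[delta _]/(delta (bract (u : C) a + v)).
have [dl dr] := delta_bimod_map C.
by rewrite (linD dl) dr.
Qed.

Definition rcoring : rcomod :=
  @RComod (rmod C) (@delta _ _ C) delta_rlinear (@delta_coassoc _ _ C)
    (@delta_counitr _ _ C).

Definition lcoring : lcomod :=
  @LComod C (@delta _ _ C) (delta_bimod_map C).1 (@delta_coassoc _ _ C)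
    (@delta_counitl _ _ C).

Definition riso (M N : rcomod) (f : M -> N) : Prop :=
  rcolinear f /\ exists g : N -> M, [/\ rcolinear g, cancel f g & cancel g f].

Definition lsplit_epi (X Y : lcomod) (f : X -> Y) : Prop :=
  lcolinear f /\ exists g : Y -> X, lcolinear g /\ cancel g f.

Definition exact_at (U V W : zmodType) (f : U -> V) (g : V -> W) : Prop :=
  forall v, g v = 0 <-> exists u, f u = v.

(* N [] X as a subset of N (x)_A X *)
Definition cotensor (N : rcomod) (X : lcomod) (y : tensor N X) : Prop :=
  tassoc N C X (tmap (M' := rtensor N C) (@rcoact N) id y)
    = tmap (N' := ltensor C X) id (@lcoact X) y.

(* Exactness of - [] X; when C is flat as a left A-module, as assumed where
   this is used, exactness in the category of right C-comodules is exactness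
   of the underlying sequences. *)
Definition coflat (X : lcomod) : Prop :=
  forall (N1 N2 N3 : rcomod) (f : N1 -> N2) (g : N2 -> N3),
    rcolinear f -> rcolinear g -> exact_at f g ->
    forall y : tensor N2 X, cotensor y ->
      tmap (N := X) (N' := X) g id y = 0
        <-> exists2 z : tensor N1 X, cotensor z & tmap (N := X) f id z = y.

End Comodules.

Section ModuleProperties.
Variable R : pzRingType.

Definition finitely_generated (V : lmodType R) : Prop :=
  exists (n : nat) (v : 'I_n -> V),
    forall x, exists a : 'I_n -> R, x = \sum_(i < n) a i *: v i.

Definition projective (V : lmodType R) : Prop :=
  forall (E F : lmodType R) (p : E -> F) (h : V -> F),
    linear p -> linear h -> (forall y, exists x, p x = y) ->
    exists2 h' : V -> E, linear h' & forall v, p (h' v) = h v.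

Definition flat (V : lmodType R) : Prop :=
  forall (E1 E2 E3 : lmodType R^c) (f : E1 -> E2) (g : E2 -> E3),
    linear f -> linear g -> exact_at f g ->
    exact_at (tmap (N := V) (N' := V) f id) (tmap (N := V) (N' := V) g id).

Definition faithfully_flat (V : lmodType R) : Prop :=
  forall (E1 E2 E3 : lmodType R^c) (f : E1 -> E2) (g : E2 -> E3),
    linear f -> linear g ->
    exact_at f g <->
    exact_at (tmap (N := V) (N' := V) f id) (tmap (N := V) (N' := V) g id).

End ModuleProperties.

Section Scalars.
Variables (k : comPzRingType) (A : kalgebra k) (M : lmodType A^c).

Let act (x : k) (m : M) : M := m <* kunit A x.
Let actA x y m : act x (act y m) = act (x * y) m.
Proof. by rewrite /act ractA -kcentral rmorphM. Qed.
Let act1 : left_id 1 act. Proof. by move=> m; rewrite /act rmorph1 ract1. Qed.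
Let actDr : right_distributive act +%R. Proof. by move=> x m n; exact: ractDl. Qed.
Let actDl m : {morph act^~ m : x y / x + y}.
Proof. by move=> x y; rewrite /act rmorphD ractDr. Qed.

Definition kmod : lmodType k := lmodule_of_action actA act1 actDr actDl.

End Scalars.

Section ColinearMaps.
Variables (k : comPzRingType) (A : kalgebra k) (C : coring A).

Section Hom.
Variables M N : rcomod C.

Definition rcolinear_pred : {pred M -> N} := fun f => `[< rcolinear f >].

Lemma rcolinear_zmod_closed : zmod_closed rcolinear_pred.
Proof.
split=> [|f g /asboolP[fl fc] /asboolP[gl gc]]; apply/asboolP.
  split=> [a u v|m]; first by rewrite scaler0 addr0.
  have -> : rcoact (0 : N) = 0 := lin0 (@rcoact_linear _ _ _ N).
  have zl : linear (0 : M -> N) by move=> a u v; rewrite scaler0 addr0.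
  have il : linear (@idfun C) by [].
  elim/tensor_ind: (rcoact m) => [n c|x y IHx IHy].
    rewrite (tmap_pure zl il); apply: (addrI (tpure N C 0 c)).
    by rewrite -tpureDl !addr0.
  by rewrite (tmapD zl il) -IHx -IHy addr0.
have hl : linear (f - g).
  move=> a u v; rewrite -[LHS]/(f _ - g _) fl gl opprD addrACA -scalerBr.
  by [].
split=> // m.
have -> : (f - g) m = f m - g m by [].
have rN := linD (@rcoact_linear _ _ _ N).
have rB (u v : N) : rcoact (u - v) = rcoact u - rcoact v.
  by apply: (addIr (rcoact v)); rewrite -rN !subrK.
rewrite rB fc gc; have il : linear (@idfun C) by [].
elim/tensor_ind: (rcoact m) => [n c|x y IHx IHy].
  rewrite !(tmap_pure _ il) //.
  by apply: (addIr (tpure N C (g n) c)); rewrite subrK -tpureDl subrK.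
rewrite !(tmapD _ il) // -IHx -IHy opprD.
by rewrite addrACA.
Qed.

HB.instance Definition _ :=
  GRing.isZmodClosed.Build (M -> N) rcolinear_pred rcolinear_zmod_closed.

Record rhom := RHom { rhom_fun :> M -> N; rhom_pred : rhom_fun \in rcolinear_pred }.

HB.instance Definition _ := [isSub for rhom_fun].
HB.instance Definition _ := [Choice of rhom by <:].
HB.instance Definition _ := [SubChoice_isSubZmodule of rhom by <:].

Lemma rhomP (f : rhom) : rcolinear f.
Proof. exact/asboolP/(rhom_pred f). Qed.

Lemma rhom_inj (f g : rhom) : f =1 g -> f = g.
Proof. by move=> fg; apply/val_inj/funext. Qed.

Definition mk_rhom (f : M -> N) (fP : rcolinear f) : rhom := RHom (asboolT fP).

End Hom.

Lemma rcolinear_id (M : rcomod C) : rcolinear (@idfun M).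
Proof.
split=> // m; have il : linear (@idfun C) by [].
have iM : linear (@idfun M) by [].
elim/tensor_ind: (rcoact m) => [n c|x y IHx IHy]; first by rewrite (tmap_pure iM il).
by rewrite (tmapD iM il) -IHx -IHy.
Qed.

Lemma rcolinear_comp (M N P : rcomod C) (g : N -> P) (f : M -> N) :
  rcolinear g -> rcolinear f -> rcolinear (g \o f).
Proof.
move=> [gl gc] [fl fc]; have il : linear (@idfun C) by [].
have gfl : linear (g \o f) by move=> a u v; rewrite /= fl gl.
split=> // m; rewrite /= gc fc.
elim/tensor_ind: (rcoact m) => [n c|x y IHx IHy]; first by rewrite !tmap_pure.
by rewrite (tmapD fl il) (tmapD gl il) (tmapD gfl il) IHx IHy.
Qed.

Definition rhom_comp (M N P : rcomod C) (g : rhom N P) (f : rhom M N) : rhom M P :=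
  mk_rhom (rcolinear_comp (rhomP g) (rhomP f)).

Section Endomorphisms.
Variable M : rcomod C.

Definition rend : Type := rhom M M.
HB.instance Definition _ := GRing.Zmodule.on rend.

Let one : rend := mk_rhom (rcolinear_id M).
Let mul (g f : rend) : rend := rhom_comp g f.
Let mulA : associative mul. Proof. by move=> f g h; exact: rhom_inj. Qed.
Let mul1 : left_id one mul. Proof. by move=> f; exact: rhom_inj. Qed.
Let mulr1' : right_id one mul. Proof. by move=> f; exact: rhom_inj. Qed.
Let mulDl : left_distributive mul +%R. Proof. by move=> f g h; exact: rhom_inj. Qed.
Let mulDr : right_distributive mul +%R.
Proof.
by move=> f g h; apply: rhom_inj => m; exact: (linD (rhomP f).1).
Qed.

HB.instance Definition _ :=
  GRing.Zmodule_isPzRing.Build rend mulA mul1 mulr1' mulDl mulDr.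

Let ev (f : rend) (m : M) : M := (f : rhom M M) m.
Let evA f g m : ev f (ev g m) = ev (f * g) m. Proof. by []. Qed.
Let ev1 : left_id 1 ev. Proof. by []. Qed.
Let evDr : right_distributive ev +%R.
Proof. by move=> f m n; exact: (linD (rhomP f).1). Qed.
Let evDl m : {morph ev^~ m : f g / f + g}. Proof. by []. Qed.

Definition endmod : lmodType rend := lmodule_of_action evA ev1 evDr evDl.

Definition endbimod : bimod rend A :=
  @Bimod rend A endmod (fun m a => (m : M) <* a)
    (@ractA A M) (@ract1 A M) (@ractDl A M) (@ractDr A M)
    (fun f m a => esym (linR (rhomP f).1 m a)).

Section HomTensor.
Variable N : rcomod C.

Let act (s : rend^c) (f : rhom M N) : rhom M N := rhom_comp f (s : rend).
Let actA s t f : act s (act t f) = act (s * t) f.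
Proof. exact: rhom_inj. Qed.
Let act1 : left_id 1 act. Proof. by move=> f; exact: rhom_inj. Qed.
Let actDr : right_distributive act +%R.
Proof. by move=> s f g; exact: rhom_inj. Qed.
Let actDl f : {morph act^~ f : s t / s + t}.
Proof. by move=> s t; apply: rhom_inj => m; exact: (linD (rhomP f).1). Qed.

Definition rhom_mod : lmodType rend^c := lmodule_of_action actA act1 actDr actDl.

Local Notation HM := (rtensor rhom_mod endbimod).

Let il : linear (@idfun C). Proof. by []. Qed.

Let inner (p : rhom_mod) : M -> HM := tpure rhom_mod endbimod p.

Let inner_linear p : linear (inner p).
Proof.
move=> a u v; rewrite /inner tpureDr; congr (_ + _).
by rewrite -[RHS]/((tpure rhom_mod endbimod p u : HM) <* (a : A)) rtensor_pure.
Qed.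

Definition hom_tensor_coact : HM -> rtensor HM C :=
  tlift (fun (p : rhom_mod) (m : endbimod) =>
    tlift (fun (m0 : M) (m1 : C) =>
      tpure HM C (tpure rhom_mod endbimod p m0) m1) (rcoact (m : M))).

Let coact_balanced : balanced (fun (p : rhom_mod) (m : endbimod) =>
  tmap (M' := HM) (N := C) (inner p) id (rcoact (m : M)) : tensor HM C).
Proof.
have idl := il; split=> [p q m|p m n|p s m].
- elim/tensor_ind: (rcoact _) => [m0 c|x y IHx IHy].
    by rewrite !(tmap_pure (inner_linear _) idl) -tpureDl -tpureDl.
  by rewrite !(tmapD (inner_linear _) idl) IHx IHy addrACA.
- rewrite -(tmapD (inner_linear _) idl); congr tmap.
  exact: (linD (@rcoact_linear _ _ _ M)).
- rewrite -[s *: m]/((s : rhom M M) (m : M)) (rhomP _).2.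
  elim/tensor_ind: (rcoact _) => [m0 c|x y IHx IHy].
    rewrite (tmap_pure (rhomP _).1 idl) !(tmap_pure (inner_linear _) idl).
    by congr tpure; exact: tpureZ.
  rewrite (tmapD (rhomP _).1 idl) !(tmapD (inner_linear _) idl).
  by rewrite IHx IHy.
Qed.

Let coactD x y :
  hom_tensor_coact (x + y) = hom_tensor_coact x + hom_tensor_coact y.
Proof. exact: tliftD coact_balanced _ _. Qed.

Let coact_pure p m : hom_tensor_coact (tpure rhom_mod endbimod p m)
  = tmap (M' := HM) (N := C) (inner p) id (rcoact (m : M)).
Proof. exact: tlift_pure coact_balanced _ _. Qed.

Let coact_linear : linear hom_tensor_coact.
Proof.
apply: rtensor_linear => [|p m a]; first exact: coactD.
have cl : bimod_map (@idfun C) by [].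
rewrite !coact_pure -(linR (tmap_rlinear (inner_linear p) cl)); congr tmap.
exact: (linR (@rcoact_linear _ _ _ M)).
Qed.

Let coact_coassoc x :
  tassoc HM C C (tmap (N := C) hom_tensor_coact id (hom_tensor_coact x))
    = tmap (N' := ltensor C C) id (@delta _ _ C) (hom_tensor_coact x).
Proof.
have dl := (delta_bimod_map C).1.
have iH : linear (@idfun HM) by [].
have iM : linear (@idfun M) by [].
have iCC : linear (@idfun (ltensor C C)) by [].
elim/tensor_ind: x => [p m|u v IHu IHv]; last first.
  by rewrite coactD (tmapD coact_linear il) tassocD (tmapD iH dl) IHu IHv.
rewrite coact_pure.
have fl := inner_linear p.
transitivity (tmap (M' := HM) (N := ltensor C C) (inner p) id
    (tassoc M C C (tmap (N := C) (@rcoact _ _ _ M) id (rcoact (m : M))))).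
  elim/tensor_ind: (rcoact _) => [m0 c|u v IHu IHv]; last first.
    by rewrite !(tmapD fl il, tmapD coact_linear il,
      tmapD (@rcoact_linear _ _ _ M) il, tassocD, tmapD fl iCC) IHu IHv.
  rewrite (tmap_pure fl il) (tmap_pure coact_linear il).
  rewrite (tmap_pure (@rcoact_linear _ _ _ M) il) coact_pure.
  elim/tensor_ind: (rcoact _) => [m1 c1|u v IHu IHv]; last first.
    rewrite (tmapD fl il) (tpureDl (M := rtensor HM C)).
    by rewrite (tpureDl (M := rtensor M C)) !tassocD (tmapD fl iCC) IHu IHv.
  by rewrite (tmap_pure fl il) !tassoc_pure (tmap_pure fl iCC).
rewrite rcoact_coassoc.
elim/tensor_ind: (rcoact _) => [m1 c1|u v IHu IHv]; last first.
  by rewrite !(tmapD iM dl, tmapD fl iCC, tmapD fl il, tmapD iH dl) IHu IHv.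
by rewrite (tmap_pure iM dl) (tmap_pure fl iCC) (tmap_pure fl il)
           (tmap_pure iH dl).
Qed.

Let coact_counit x :
  tlift (fun (y : HM) (c : C) => y <* (eps c : A)) (hom_tensor_coact x) = x.
Proof.
have [el er] := eps_bimod_map C.
have bal (Q : lmodType A^c) : balanced (fun (y : Q) (c : C) => y <* (eps c : A)).
  split=> [y z c|y c d|y r c]; first exact: ractDl.
    by rewrite (linD el) ractDr.
  by rewrite ractA (linZ el).
elim/tensor_ind: x => [p m|u v IHu IHv]; last first.
  by rewrite coactD (tliftD (bal HM)) IHu IHv.
rewrite coact_pure -[in RHS](rcoact_counit (m : M)) -/(inner p _).
elim/tensor_ind: (rcoact _) => [m0 c|u v IHu IHv]; last first.
  rewrite (tmapD (inner_linear p) il) !(tliftD (bal _)) IHu IHv.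
  by rewrite (linD (inner_linear p)).
rewrite (tmap_pure (inner_linear p) il) !(tlift_pure (bal _)).
by rewrite (linR (inner_linear p)).
Qed.

(* Hom(M, N) (x)_S M with S = End(M) and coaction p (x) m |-> (p (x) m0) (x) m1 *)
Definition hom_tensor : rcomod C :=
  @RComod _ _ C HM hom_tensor_coact coact_linear coact_coassoc coact_counit.

Definition hom_eval : hom_tensor -> N :=
  tlift (fun (p : rhom_mod) (m : endbimod) => (p : rhom M N) (m : M)).

Lemma hom_eval_balanced :
  balanced (fun (p : rhom_mod) (m : endbimod) => (p : rhom M N) (m : M)).
Proof. by split=> // p m n; exact: (linD (rhomP (p : rhom M N)).1). Qed.

End HomTensor.
End Endomorphisms.

Definition galois (M : rcomod C) : Prop :=
  [/\ finitely_generated M, projective M & riso (@hom_eval M (rcoring C))].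

Definition principal (M : rcomod C) : Prop :=
  galois M /\ projective (endmod M).

End ColinearMaps.

(* The canonical map D (x)_A D -> D (x)_B D along alpha : A -> B *)
Definition tensor_chi (A B : pzRingType) (alpha : {rmorphism A -> B})
    (D : bimod B B) :
  tensor (rmod (birestr alpha D)) (birestr alpha D) -> tensor (rmod D) D :=
  tlift (fun (d : rmod (birestr alpha D)) (d' : birestr alpha D) =>
    tpure (rmod D) D d d').

Section CoringMorphism.
Variables (k : comPzRingType) (A B : kalgebra k) (C : coring A) (D : coring B).

Record coring_mor := CoringMor {
  cm_alg : {rmorphism A -> B};
  cm_alg_unit : forall x : k, cm_alg (kunit A x) = kunit B x;
  cm_map : C -> birestr cm_alg D;
  cm_bimod_map : bimod_map cm_map;
  cm_delta : forall c : C,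
    tensor_chi (tmap (M := rmod C) (M' := rmod (birestr cm_alg D))
                     cm_map cm_map (delta c)) = delta (cm_map c : D);
  cm_eps : forall c : C, (eps (cm_map c : D) : B) = cm_alg (eps c : A)
}.

Variable phi : coring_mor.
Local Notation alpha := (cm_alg phi).
Local Notation gamma := (@cm_map phi).

Let il : linear (@idfun D). Proof. by []. Qed.
Let gl : linear gamma. Proof. exact: (cm_bimod_map phi).1. Qed.

Let gD c d : (gamma (c + d) : D) = (gamma c : D) + (gamma d : D).
Proof. exact: (linD gl). Qed.
Let gZ a c : (gamma (a *: c) : D) = alpha a *: (gamma c : D).
Proof. exact: (linZ gl). Qed.
Let gR c a : (gamma (bract c a) : D) = bract (gamma c : D) (alpha a).
Proof. exact: (cm_bimod_map phi).2. Qed.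

Let gDD (z : btensor C C) : btensor D D :=
  tensor_chi (tmap (M := rmod C) (M' := rmod (birestr alpha D)) gamma gamma z).

Let gl' : linear (gamma : rmod C -> rmod (birestr alpha D)).
Proof. by move=> a u v; rewrite gD; congr (_ + _); exact: gR. Qed.

Let chi_balanced : balanced
  (fun (d : rmod (birestr alpha D)) (d' : birestr alpha D) =>
    tpure (rmod D) D d d').
Proof.
split=> [c c' d|c d d'|c a d]; first exact: tpureDl; first exact: tpureDr.
exact: (tpureZ (M := rmod D) c (alpha a) d).
Qed.

Let gDD_D y z : gDD (y + z) = gDD y + gDD z.
Proof. by rewrite /gDD (tmapD gl' gl); exact: tliftD chi_balanced _ _. Qed.

Let gDD_pure (c d : C) : gDD (tpure (rmod C) C c d)
  = tpure (rmod D) D (gamma c : D) (gamma d : D).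
Proof. by rewrite /gDD (tmap_pure gl' gl); exact: tlift_pure chi_balanced _ _. Qed.

Let gDD_Z a z : gDD (a *: z) = alpha a *: gDD z.
Proof.
elim/tensor_ind: z => [c d|u v IHu IHv].
  rewrite -[a *: _]/(a *: (tpure (rmod C) C c d : ltensor C C)) ltensor_pure.
  rewrite !gDD_pure.
  rewrite -[RHS]/(alpha a *: (tpure (rmod D) D (gamma c : D) (gamma d : D)
                              : ltensor D D)) ltensor_pure.
  by congr tpure; exact: gZ.
rewrite -[a *: _]/(a *: ((u + v) : ltensor C C)).
by rewrite (scalerDr a (u : ltensor C C)) !gDD_D IHu IHv -scalerDr.
Qed.

Let gDD_R z a : gDD (bract z a) = bract (gDD z) (alpha a).
Proof.
elim/tensor_ind: z => [c d|u v IHu IHv].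
  rewrite -[bract _ _]/((tpure (rmod C) C c d : rtensor (rmod C) C) <* a).
  rewrite rtensor_pure !gDD_pure.
  rewrite -[RHS]/((tpure (rmod D) D (gamma c : D) (gamma d : D)
                              : rtensor (rmod D) D) <* alpha a) rtensor_pure.
  by congr tpure; exact: gR.
by rewrite (@bractDl _ _ (btensor C C)) !gDD_D IHu IHv -bractDl.
Qed.

Let gDD_delta c : gDD (delta c) = delta (gamma c : D).
Proof. exact: cm_delta. Qed.

Section InducedRight.
Variable M : rcomod C.

Local Notation Bm := (lrestr alpha (regular B)).
Local Notation MB := (rtensor M Bm).

Let inner (b : B) (m0 : M) (m1 : C) : rtensor MB D :=
  tpure MB D (tpure M Bm m0 (1 : B)) (bract (gamma m1 : D) b).

(* m (x) b |-> (m0 (x) 1) (x) gamma(m1) b *)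
Definition ind_rcoact : MB -> rtensor MB D :=
  tlift (fun (m : M) (b : Bm) => tlift
    (fun (m0 : M) (m1 : C) =>
      tpure MB D (tpure M Bm m0 (1 : B)) (bract (gamma m1 : D) (b : B)))
    (rcoact m)).

Let ract_one (m : M) (b : B) : (tpure M Bm m (1 : B) : MB) <* b = tpure M Bm m b.
Proof. by rewrite rtensor_pure; congr tpure; exact: mul1r. Qed.

Let one_bal (m : M) (a : A) :
  tpure M Bm (m <* a) (1 : B) = (tpure M Bm m (1 : B) : MB) <* alpha a.
Proof.
by rewrite ract_one tpureZ; congr tpure; exact: mulr1.
Qed.

Let inner_balanced b : balanced (inner b).
Proof.
split=> [m m' c|m c d|m a c]; rewrite /inner.
- by rewrite -(tpureDl (M := MB)); congr tpure; exact: tpureDl.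
- by rewrite gD bractDl tpureDr.
- by rewrite one_bal tpureZ gZ bractZ.
Qed.

Let innerD b := tliftD (inner_balanced b).

Let inner_ract (y : tensor M C) (b b' : B) :
  tlift (inner (b * b')) y = (tlift (inner b) y : rtensor MB D) <* b'.
Proof.
elim/tensor_ind: y => [m c|u v IHu IHv]; last first.
  by rewrite !innerD IHu IHv -ractDl.
by rewrite !(tlift_pure (inner_balanced _)) /inner rtensor_pure bractA.
Qed.

Let inner_Db (y : tensor M C) (b b' : B) :
  tlift (inner (b + b')) y = tlift (inner b) y + tlift (inner b') y.
Proof.
elim/tensor_ind: y => [m c|u v IHu IHv]; last first.
  by rewrite !innerD IHu IHv addrACA.
by rewrite !(tlift_pure (inner_balanced _)) /inner bractDr tpureDr.
Qed.

Let coact_balanced :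
  balanced (fun (m : M) (b : Bm) => tlift (inner (b : B)) (rcoact m)).
Proof.
split=> [m m' b|m b b'|m a b].
- by rewrite (linD (@rcoact_linear _ _ _ M)) innerD.
- exact: inner_Db.
- rewrite (linR (@rcoact_linear _ _ _ M)).
  elim/tensor_ind: (rcoact m) => [m0 c|u v IHu IHv]; last first.
    by rewrite (ractDl (M := rtensor M C)) !innerD IHu IHv.
  rewrite rtensor_pure !(tlift_pure (inner_balanced _)) /inner gR bractA.
  by [].
Qed.

Let coactD x y : ind_rcoact (x + y) = ind_rcoact x + ind_rcoact y.
Proof. exact: tliftD coact_balanced _ _. Qed.

Let coact_pure m (b : B) :
  ind_rcoact (tpure M Bm m b) = tlift (inner b) (rcoact m).
Proof. exact: tlift_pure coact_balanced _ _. Qed.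

Let coact_linear : linear ind_rcoact.
Proof.
apply: rtensor_linear => [|m b b']; first exact: coactD.
by rewrite !coact_pure inner_ract.
Qed.

Let outer (b : B) (m : M) (z : ltensor C C) : tensor MB (ltensor D D) :=
  tpure MB (ltensor D D) (tpure M Bm m (1 : B)) (bract (gDD z) b).

Let outer_balanced b : balanced (outer b).
Proof.
split=> [m m' z|m y z|m a z]; rewrite /outer.
- by rewrite -(tpureDl (M := MB)); congr tpure; exact: tpureDl.
- by rewrite gDD_D bractDl tpureDr.
- by rewrite one_bal tpureZ gDD_Z bractZ.
Qed.

Let coact_coassoc x :
  tassoc MB D D (tmap (N := D) ind_rcoact id (ind_rcoact x))
    = tmap (N' := ltensor D D) id (@delta _ _ D) (ind_rcoact x).
Proof.
have [dl dr] := delta_bimod_map D.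
have iMB : linear (@idfun MB) by [].
have iM : linear (@idfun M) by [].
have rl := @rcoact_linear _ _ _ M.
elim/tensor_ind: x => [m b|u v IHu IHv]; last first.
  by rewrite coactD (tmapD coact_linear il) tassocD (tmapD iMB dl) IHu IHv.
rewrite coact_pure.
have innerE b' m0 c := tlift_pure (inner_balanced b') m0 c.
have outerE b' m0 z := tlift_pure (outer_balanced b') m0 z.
have outerD b' := tliftD (outer_balanced b').
have iC : linear (@idfun C) by [].
have dCl := (delta_bimod_map C).1.
transitivity (tlift (outer b)
    (tassoc M C C (tmap (N := C) (@rcoact _ _ _ M) id (rcoact (m : M))))).
  elim/tensor_ind: (rcoact _) => [m0 c|u v IHu IHv]; last first.
    by rewrite innerD (tmapD coact_linear il) (tmapD rl iC) !tassocD outerD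
               IHu IHv.
  rewrite innerE {1}/inner (tmap_pure coact_linear il) (tmap_pure rl iC).
  rewrite coact_pure.
  elim/tensor_ind: (rcoact _) => [m1 c1|u v IHu IHv]; last first.
    rewrite innerD (tpureDl (M := rtensor MB D)).
    by rewrite (tpureDl (M := rtensor M C)) !tassocD outerD IHu IHv.
  rewrite innerE /inner bract1 !tassoc_pure outerE /outer gDD_pure.
  congr tpure; symmetry; exact: rtensor_pure.
rewrite rcoact_coassoc.
elim/tensor_ind: (rcoact _) => [m1 c1|u v IHu IHv]; last first.
  by rewrite (tmapD iM dCl) outerD innerD (tmapD iMB dl) IHu IHv.
rewrite (tmap_pure iM dCl) outerE innerE /outer /inner (tmap_pure iMB dl).
by rewrite gDD_delta -dr.
Qed.

Let coact_counit x :
  tlift (fun (y : MB) (d : D) => y <* (eps d : B)) (ind_rcoact x) = x.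
Proof.
have bal (k' : comPzRingType) (A' : kalgebra k') (C' : coring A')
    (Q : lmodType A'^c) : balanced (fun (y : Q) (c : C') => y <* (eps c : A')).
  have [el er] := eps_bimod_map C'.
  split=> [y z c|y c d|y r c]; first exact: ractDl.
    by rewrite (linD el) ractDr.
  by rewrite ractA (linZ el).
have [el er] := eps_bimod_map D.
elim/tensor_ind: x => [m b|u v IHu IHv]; last first.
  by rewrite coactD (tliftD (bal _ _ D MB)) IHu IHv.
rewrite coact_pure -[in RHS](rcoact_counit (m : M)).
elim/tensor_ind: (rcoact _) => [m0 c|u v IHu IHv]; last first.
  by rewrite innerD !(tliftD (bal _ _ _ _)) IHu IHv tpureDl.
rewrite (tlift_pure (inner_balanced b)) /inner !(tlift_pure (bal _ _ _ _)).
rewrite er -[bract _ _]/((eps (gamma c : D) : B) * b) cm_eps.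
by rewrite -ractA -one_bal ract_one.
Qed.

(* M (x)_A B *)
Definition ind_rcomod : rcomod D :=
  @RComod _ _ D MB ind_rcoact coact_linear coact_coassoc coact_counit.

End InducedRight.

Section InducedLeft.
Variable X : lcomod C.

Local Notation Bm := (rrestr alpha (regular B)).
Local Notation BX := (ltensor Bm X).
Local Notation pBX := (tpure (rmod Bm) X).

Let inner (b : B) (c : rmod C) (x : X) : ltensor D BX :=
  tpure (rmod D) BX (b *: (gamma c : D)) (pBX (1 : B) x).

(* b (x) x |-> b gamma(x1) (x) (1 (x) x0) *)
Definition ind_lcoact : BX -> ltensor D BX :=
  tlift (fun (b : rmod Bm) (x : X) => tlift
    (fun (x1 : rmod C) (x0 : X) =>
      tpure (rmod D) BX ((b : B) *: (gamma x1 : D)) (pBX (1 : B) x0))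
    (lcoact x)).

Let scale_one (b : B) (x : X) : b *: (pBX (1 : B) x : BX) = pBX b x.
Proof. by rewrite ltensor_pure; congr tpure; exact: mulr1. Qed.

Let one_bal (a : A) (x : X) :
  pBX (1 : B) (a *: x) = alpha a *: (pBX (1 : B) x : BX).
Proof. by rewrite scale_one -tpureZ; congr tpure; exact: mul1r. Qed.

Let inner_balanced b : balanced (inner b).
Proof.
split=> [c d x|c x y|c a x]; rewrite /inner.
- rewrite -tpureDl; congr tpure.
  by rewrite -[RHS](@scalerDr B D) -gD.
- by rewrite -tpureDr; congr tpure; exact: tpureDr.
- rewrite one_bal -tpureZ; congr tpure.
  rewrite -[RHS]/(bract (b *: (gamma c : D)) (alpha a)) bractZ -gR.
  by [].
Qed.

Let innerD b := tliftD (inner_balanced b).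
Let innerE b c x := tlift_pure (inner_balanced b) c x.

Let inner_scale (y : tensor (rmod C) X) (b b' : B) :
  tlift (inner (b * b')) y = b *: (tlift (inner b') y : ltensor D BX).
Proof.
elim/tensor_ind: y => [c x|u v IHu IHv]; last first.
  by rewrite !innerD IHu IHv -scalerDr.
by rewrite !innerE /inner ltensor_pure scalerA.
Qed.

Let inner_Db (y : tensor (rmod C) X) (b b' : B) :
  tlift (inner (b + b')) y = tlift (inner b) y + tlift (inner b') y.
Proof.
elim/tensor_ind: y => [c x|u v IHu IHv]; last first.
  by rewrite !innerD IHu IHv addrACA.
by rewrite !innerE /inner scalerDl -tpureDl.
Qed.

Let coact_balanced :
  balanced (fun (b : rmod Bm) (x : X) => tlift (inner (b : B)) (lcoact x)).
Proof.
have ll := @lcoact_linear _ _ _ X.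
split=> [b b' x|b x y|b a x].
- exact: inner_Db.
- by rewrite (linD ll) innerD.
- rewrite (linZ ll).
  elim/tensor_ind: (lcoact x) => [c x0|u v IHu IHv]; last first.
    by rewrite (scalerDr a (u : ltensor C X)) !innerD IHu IHv.
  rewrite ltensor_pure !innerE /inner gZ scalerA.
  by [].
Qed.

Let coactD x y : ind_lcoact (x + y) = ind_lcoact x + ind_lcoact y.
Proof. exact: tliftD coact_balanced _ _. Qed.

Let coact_pure (b : B) x :
  ind_lcoact (pBX b x) = tlift (inner b) (lcoact x).
Proof. exact: tlift_pure coact_balanced _ _. Qed.

Let coact_linear : linear ind_lcoact.
Proof.
apply: ltensor_linear => [|b b' x]; first exact: coactD.
by rewrite !coact_pure -inner_scale.
Qed.

Let inner1_Z a (z : ltensor C X) :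
  tlift (inner 1) (a *: z) = alpha a *: (tlift (inner 1) z : ltensor D BX).
Proof.
elim/tensor_ind: z => [c x|u v IHu IHv]; last first.
  by rewrite (scalerDr a (u : ltensor C X)) !innerD IHu IHv -scalerDr.
rewrite ltensor_pure !innerE /inner ltensor_pure gZ !scale1r.
by [].
Qed.

Let outer (b : B) (c : rmod C) (z : ltensor C X) : tensor (rmod D) (ltensor D BX) :=
  tpure (rmod D) (ltensor D BX) (b *: (gamma c : D)) (tlift (inner 1) z).

Let outer_balanced b : balanced (outer b).
Proof.
split=> [c d z|c y z|c a z]; rewrite /outer.
- rewrite -tpureDl; congr tpure.
  by rewrite -[RHS](@scalerDr B D) -gD.
- by rewrite innerD tpureDr.
- rewrite inner1_Z -tpureZ; congr tpure.
  rewrite -[RHS]/(bract (b *: (gamma c : D)) (alpha a)) bractZ -gR.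
  by [].
Qed.

Let coact_coassoc x :
  tassoc (rmod D) D BX
      (tmap (M := rmod D) (M' := rtensor (rmod D) D)
            (@delta _ _ D) id (ind_lcoact x))
    = tmap (M := rmod D) id ind_lcoact (ind_lcoact x).
Proof.
have dr := @delta_rlinear _ _ D.
have [dl _] := delta_bimod_map D.
have iBX : linear (@idfun BX) by [].
have iX : linear (@idfun X) by [].
have iD : linear (@idfun (rmod D)) by [].
have iC : linear (@idfun (rmod C)) by [].
have ll := @lcoact_linear _ _ _ X.
have dCr := @delta_rlinear _ _ C.
elim/tensor_ind: x => [b x|u v IHu IHv]; last first.
  by rewrite coactD (tmapD dr iBX) tassocD (tmapD iD coact_linear) IHu IHv.
rewrite coact_pure.
have outerE c z := tlift_pure (outer_balanced b) c z.
have outerD := tliftD (outer_balanced b).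
transitivity (tlift (outer b) (tassoc (rmod C) C X
    (tmap (M := rmod C) (M' := rtensor (rmod C) C)
          (@delta _ _ C) id (lcoact x)))); last first.
  rewrite lcoact_coassoc.
  elim/tensor_ind: (lcoact _) => [c x0|u v IHu IHv]; last first.
    by rewrite innerD (tmapD iC ll) outerD (tmapD iD coact_linear) IHu IHv.
  rewrite (tmap_pure iC ll) outerE innerE /outer /inner.
  by rewrite (tmap_pure iD coact_linear) coact_pure.
elim/tensor_ind: (lcoact _) => [c x0|u v IHu IHv]; last first.
  by rewrite innerD (tmapD dr iBX) (tmapD dCr iX) !tassocD outerD IHu IHv.
rewrite innerE {1}/inner (tmap_pure dr iBX) (tmap_pure dCr iX).
rewrite (linZ dl) -gDD_delta.
elim/tensor_ind: (delta c) => [c1 c2|u v IHu IHv]; last first.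
  rewrite (tpureDl (M := rtensor (rmod C) C)) tassocD outerD -IHu -IHv.
  rewrite gDD_D scalerDr -tassocD; congr tassoc.
  exact: (tpureDl (M := rtensor (rmod D) D)).
rewrite gDD_pure tassoc_pure outerE /outer innerE /inner scale1r.
rewrite -tassoc_pure; congr tassoc; congr tpure.
exact: ltensor_pure.
Qed.

Let coact_counit x :
  tlift (fun (d : rmod D) (y : BX) => (eps d : B) *: y) (ind_lcoact x) = x.
Proof.
have bal (k' : comPzRingType) (A' : kalgebra k') (C' : coring A')
    (Q : lmodType A') : balanced (fun (c : rmod C') (y : Q) => (eps c : A') *: y).
  have [el er] := eps_bimod_map C'.
  split=> [c d y|c y z|c r y]; last 2 first.
  - exact: scalerDr.
  - rewrite -[c <* r]/(bract (c : C') r) er.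
    by rewrite scalerA.
  - rewrite -scalerDl; congr (_ *: _); exact: (linD el).
have [el er] := eps_bimod_map D.
elim/tensor_ind: x => [b x|u v IHu IHv]; last first.
  by rewrite coactD (tliftD (bal _ _ D BX)) IHu IHv.
rewrite coact_pure -[in RHS](lcoact_counit (x : X)).
elim/tensor_ind: (lcoact _) => [c x0|u v IHu IHv]; last first.
  by rewrite innerD !(tliftD (bal _ _ _ _)) IHu IHv tpureDr.
rewrite innerE /inner !(tlift_pure (bal _ _ _ _)).
rewrite (linZ el) -[b *: _]/(b * (eps (gamma c : D) : B)) cm_eps.
by rewrite -scalerA -one_bal scale_one.
Qed.

(* B (x)_A X *)
Definition ind_lcomod : lcomod D :=
  @LComod _ _ D BX ind_lcoact coact_linear coact_coassoc coact_counit.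

End InducedLeft.

Definition gamma_tilde : ind_lcomod (lcoring C) -> lcoring D :=
  tlift (fun (b : rmod (rrestr alpha (regular B))) (c : C) =>
    (b : B) *: (gamma c : D)).

Lemma gamma_tilde_balanced :
  balanced (fun (b : rmod (rrestr alpha (regular B))) (c : C) =>
    (b : B) *: (gamma c : D)).
Proof.
split=> [b b' c|b c d|b a c]; first exact: (@scalerDl B D).
  by rewrite gD scalerDr.
by rewrite gZ scalerA.
Qed.

End CoringMorphism.

Arguments gamma_tilde {k A B C D} phi _.

(* Main.v *)
Require Import Defs.
From HB Require Import structures.
From mathcomp Require Import all_boot all_algebra.
From mathcomp Require Import boolp functions.

(** A finitely generated projective comodule [M] is principal as soon as there
    is a left colinear section of a map [(xi_i)_i |-> sum_i xi_i(e_i0) e_i1]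
    from a direct sum of copies of the dual [M^* = Hom_A(M, A)] to [C], for some
    family [e] of elements of [M]; and principal comodules all have such
    sections.  Sections of this kind are easy to push along a morphism of
    corings, and this gives the theorem.

    From principal to section ([left_section_of_principal]): let
    [S = End^C(M)].  Since [M] is projective over [S], the action
    [S^(M) -> M] of the free module on the elements of [M] has an [S]-linear
    section.  Tensoring it over [S] with [M^* ~ Hom^C(M, C)], and using
    [M^* (x)_S M ~ C], gives a left colinear section of [(M^* )^(M) -> C].

    Base change ([left_section_base_change]): a section [sigma] of
    [B (x)_A C -> D], followed by [B (x)_A (C -> (M^* )^(I))] and
    [B (x)_A M^* ~ (M (x)_A B)^*], is a section for [M (x)_A B].

    From section to principal ([principal_of_left_section]): let
    [tau : C -> (M^* )^(I)] be a section.  The endomorphisms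
    [t_i(m) : n |-> m0 tau_i(m1)(n)] are colinear because [tau] is, they depend
    [S]-linearly on [m], and [sum_i t_i(m)(e_i) = m].  So [(e_i, t_i)] is a
    dual basis and [M] is [S]-projective.  The same formulas make
    [c |-> sum_i tau_i(c) (x) e_i] the inverse of the evaluation
    [M^* (x)_S M -> C]: indeed
    [xi (x) m = sum_i xi t_i(m) (x) e_i] and [xi t_i(m) = tau_i(xi(m0) m1)].

    Sections with values in a direct sum are handled as families of maps that
    are locally finite in the argument, and projectivity as existence of a
    dual basis ([projective_dual_basis], [dual_basis_projective]).  Linear maps
    [M -> A] and colinear maps [M -> C] are exchanged through
    [xi |-> (m |-> xi(m0) m1)] ([coext]) and composition with the counit. *)

Set Implicit Arguments.
Unset Strict Implicit.
Unset Printing Implicit Defensive.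

Import GRing.Theory.
Local Open Scope ring_scope.

(** * Finite support, free modules and dual bases *)

Section FiniteSupport.
Variables (I : eqType) (V : zmodType).
Implicit Types (s t : seq I) (f g : I -> V).

(** Uniqueness of the entries makes the sum over a covering sequence the sum of
    the whole family. *)
Definition covers s f := uniq s /\ forall i, i \notin s -> f i = 0.

Lemma covers_sum s t f :
  covers s f -> covers t f -> \sum_(i <- s) f i = \sum_(i <- t) f i.
Proof.
have restrict u v : covers v f ->
    \sum_(i <- u) f i = \sum_(i <- [seq i <- u | i \in v]) f i.
  case=> _ fv; rewrite big_filter; symmetry; apply: big_rmcond => i; exact: fv.
move=> cs ct; rewrite (restrict s t ct) (restrict t s cs).
apply: perm_big; apply: uniq_perm; rewrite ?filter_uniq //.
- exact: cs.1.
- exact: ct.1.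
by move=> i; rewrite !mem_filter andbC.
Qed.

Lemma coversW s t f :
  covers s f -> uniq t -> {subset s <= t} -> covers t f.
Proof. by move=> [_ fs] ut st; split=> // i it; apply/fs/(contra (st i)). Qed.

Lemma covers_catl s t f : covers s f -> covers (undup (s ++ t)) f.
Proof.
move=> cs; apply: (coversW cs); rewrite ?undup_uniq // => i.
by rewrite mem_undup mem_cat => ->.
Qed.

Lemma covers_catr s t f : covers t f -> covers (undup (s ++ t)) f.
Proof.
move=> ct; apply: (coversW ct); rewrite ?undup_uniq // => i.
by rewrite mem_undup mem_cat orbC => ->.
Qed.

Lemma coversD s f g : covers s f -> covers s g -> covers s (fun i => f i + g i).
Proof. by move=> [us fs] [_ gs]; split=> // i si; rewrite fs ?gs ?addr0. Qed.

End FiniteSupport.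

Lemma covers_comp (I : eqType) (V W : zmodType) (s : seq I) (f : I -> V)
    (h : I -> V -> W) :
  (forall i, h i 0 = 0) -> covers s f -> covers s (fun i => h i (f i)).
Proof. by move=> h0 [us fs]; split=> // i /fs ->. Qed.

(** Two sums with different supports are added over a common support. *)
Lemma covers_add (I : eqType) (V W : zmodType) (s t : seq I) (f g : I -> V)
    (h : I -> V -> W) :
    (forall i, {morph h i : x y / x + y}) -> covers s f -> covers t g ->
  exists2 u, covers u (fun i => f i + g i) &
    \sum_(i <- u) h i (f i + g i)
      = \sum_(i <- s) h i (f i) + \sum_(i <- t) h i (g i).
Proof.
move=> hD cs ct; have cu := covers_catl t cs; have cv := covers_catr s ct.
have h0 i : h i 0 = 0 by apply: (addrI (h i 0)); rewrite -hD !addr0.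
exists (undup (s ++ t)); first exact: coversD.
rewrite (covers_sum (covers_comp h0 cs) (covers_comp h0 cu)).
rewrite (covers_sum (covers_comp h0 ct) (covers_comp h0 cv)) -big_split.
by apply: eq_bigr => i _; rewrite hD.
Qed.

Lemma lin_sum (R : pzRingType) (U V : lmodType R) (f : U -> V) (I : Type)
    (s : seq I) (F : I -> U) :
  linear f -> f (\sum_(i <- s) F i) = \sum_(i <- s) f (F i).
Proof. by move=> fl; apply: big_morph; [exact: linD | exact: lin0]. Qed.

Lemma covers_scale (R : pzRingType) (V : lmodType R) (I : eqType) (s : seq I)
    (c : I -> R) (e : I -> V) :
  covers s c -> covers s (fun i => c i *: e i).
Proof.
by apply: (covers_comp (h := fun i x => x *: e i)) => i; exact: scale0r.
Qed.

Section FreeModule.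
Variables (R : pzRingType) (I : choiceType).

(** The finitely supported functions form the free module on [I]. *)
Definition finsupp_pred : {pred I -> R} :=
  fun f => `[< exists s, covers s f >].

Lemma finsupp_zmod_closed : zmod_closed finsupp_pred.
Proof.
split=> [|f g /asboolP[s cs] /asboolP[t ct]]; apply/asboolP.
  by exists [::]; split.
exists (undup (s ++ t)); apply: coversD (covers_catl _ cs) _.
apply: (covers_comp (h := fun _ x => - x)) (covers_catr _ ct) => _.
exact: oppr0.
Qed.

HB.instance Definition _ :=
  GRing.isZmodClosed.Build (I -> R) finsupp_pred finsupp_zmod_closed.

Record finsupp :=
  Finsupp { finsupp_fun :> I -> R; finsuppP : finsupp_fun \in finsupp_pred }.

HB.instance Definition _ := [isSub for finsupp_fun].
HB.instance Definition _ := [Choice of finsupp by <:].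
HB.instance Definition _ := [SubChoice_isSubZmodule of finsupp by <:].

Lemma finsupp_inj (f g : finsupp) : f =1 g -> f = g.
Proof. by move=> fg; apply/val_inj/funext. Qed.

Lemma finsupp_covers (f : finsupp) : exists s, covers s f.
Proof. exact/asboolP/finsuppP. Qed.

Let actP (r : R) (f : finsupp) : (fun i => r * f i) \in finsupp_pred.
Proof.
have [s cs] := finsupp_covers f; apply/asboolP; exists s.
by apply: (covers_comp (h := fun _ x => r * x)) cs => _; rewrite mulr0.
Qed.

Let act r f : finsupp := Finsupp (actP r f).
Let actA r s f : act r (act s f) = act (r * s) f.
Proof. by apply: finsupp_inj => i /=; rewrite mulrA. Qed.
Let act1 : left_id 1 act.
Proof. by move=> f; apply: finsupp_inj => i /=; rewrite mul1r. Qed.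
Let actDr : right_distributive act +%R.
Proof. by move=> r f g; apply: finsupp_inj => i; exact: mulrDr. Qed.
Let actDl f : {morph act^~ f : r s / r + s}.
Proof. by move=> r s; apply: finsupp_inj => i; exact: mulrDl. Qed.

Definition freemod : lmodType R := lmodule_of_action actA act1 actDr actDl.

Definition coord (i : I) (f : freemod) : R := (f : finsupp) i.

Lemma coord_linear i : linear (coord i : freemod -> R^o).
Proof. by []. Qed.

Lemma coord_covers (f : freemod) : exists s, covers s (coord^~ f).
Proof. exact: finsupp_covers. Qed.

Lemma free_basis (i : I) : exists d : freemod,
  forall j, coord j d = (j == i)%:R.
Proof.
have dP : (fun j => (j == i)%:R) \in finsupp_pred.
  apply/asboolP; exists [:: i]; split=> // j.
  by rewrite inE => /negbTE ->.
by exists (Finsupp dP).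
Qed.

End FreeModule.

Arguments coord {R I} i f.

Section DualBasis.
Variables (R : pzRingType) (V : lmodType R).

Definition dual_basis (I : eqType) (e : I -> V) (u : I -> V -> R) : Prop :=
  (forall i, linear (u i : V -> R^o)) /\
  forall v, exists2 s, covers s (u^~ v) & \sum_(i <- s) u i v *: e i = v.

Lemma dual_basis_sum (I : eqType) (e : I -> V) (u : I -> V -> R) :
    dual_basis e u ->
  forall v s, covers s (u^~ v) -> \sum_(i <- s) u i v *: e i = v.
Proof.
move=> [_ due] v s cs; have [t ct {2}<-] := due v.
exact: covers_sum (covers_scale _ cs) (covers_scale _ ct).
Qed.

(** Lift the identity of [V] through the action of the free module on the
    elements of [V], and take coordinates. *)
Lemma projective_dual_basis :
  projective V -> exists u : V -> V -> R, dual_basis id u.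
Proof.
move=> projV; pose F := freemod R V.
have [supp suppP] := choice (@coord_covers R V).
pose p (f : F) : V := \sum_(i <- supp f) coord i f *: (i : V).
have pE (f : F) s :
    covers s (coord^~ f) -> p f = \sum_(i <- s) coord i f *: (i : V).
  move=> cs.
  exact: covers_sum (covers_scale _ (suppP f)) (covers_scale _ cs).
have pl : linear p.
  move=> a f g.
  have coordD i : coord i (a *: f + g) = a * coord i f + coord i g.
    exact: coord_linear.
  set s := undup (supp f ++ supp g).
  have cf : covers s (coord^~ f) := covers_catl _ (suppP f).
  have cg : covers s (coord^~ g) := covers_catr _ (suppP g).
  rewrite (pE f s) // (pE g s) // (pE _ s).
    rewrite scaler_sumr -big_split; apply: eq_bigr => i _.
    by rewrite coordD scalerDl scalerA.
  split=> [|i si]; first exact: cf.1.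
  by rewrite coordD (cf.2 i si) (cg.2 i si) mulr0 addr0.
have psurj v : exists f : F, p f = v.
  have [d dE] := free_basis R v; exists d; rewrite (pE d [:: v]).
    by rewrite big_seq1 dE eqxx scale1r.
  by split=> // j; rewrite dE inE => /negbTE ->.
have idl : linear (@idfun V) by [].
have [h hl ph] := projV F V p idfun pl idl psurj.
exists (fun i v => coord i (h v)); split=> [i a v w|v].
  by rewrite hl coord_linear.
by exists (supp (h v)); [exact: suppP | exact: ph].
Qed.

Lemma dual_basis_projective (I : eqType) (e : I -> V) (u : I -> V -> R) :
  dual_basis e u -> projective V.
Proof.
move=> bas E F p h pl hl psurj.
have [supp suppP] : {supp : V -> seq I & forall v, covers (supp v) (u^~ v)}.
  apply: (@choice V (seq I) (fun v s => covers s (u^~ v))) => v.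
  by have [s] := bas.2 v; exists s.
have [y yP] := choice (fun i => psurj (h (e i))).
pose h' v := \sum_(i <- supp v) u i v *: y i.
have h'E v s : covers s (u^~ v) -> h' v = \sum_(i <- s) u i v *: y i.
  move=> cs.
  exact: covers_sum (covers_scale _ (suppP v)) (covers_scale _ cs).
exists h' => [a v w|v].
  have uD i : u i (a *: v + w) = a * u i v + u i w by exact: bas.1.
  set s := undup (supp v ++ supp w).
  have cv : covers s (u^~ v) := covers_catl _ (suppP v).
  have cw : covers s (u^~ w) := covers_catr _ (suppP w).
  rewrite (h'E v s) // (h'E w s) // (h'E _ s).
    rewrite scaler_sumr -big_split; apply: eq_bigr => i _ /=.
    by rewrite uD scalerDl scalerA.
  split=> [|i si]; first exact: cv.1.
  by rewrite uD (cv.2 i si) (cw.2 i si) mulr0 addr0.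
rewrite -[in RHS](dual_basis_sum bas (suppP v)).
rewrite (lin_sum _ _ hl) (lin_sum _ _ pl).
by apply: eq_bigr => i _; rewrite (linZ pl) (linZ hl) yP.
Qed.

(** The basis elements also serve as indices, as in [projective_dual_basis]. *)
Definition finite_dual_basis (s : seq V) (u : V -> V -> R) : Prop :=
  (forall i, linear (u i : V -> R^o)) /\
  forall v, \sum_(i <- s) u i v *: (i : V) = v.

(** The coordinate forms vanishing on a finite set of generators vanish
    everywhere, so finitely many basis elements suffice. *)
Lemma fg_projective_dual_basis :
    finitely_generated V -> projective V ->
  exists s u, finite_dual_basis s u.
Proof.
move=> [n [g gP]] /projective_dual_basis[u bas].
have [s sP] : exists s, forall j, covers s (u^~ (g j)).
  have [t tP] : {t : 'I_n -> seq V & forall j, covers (t j) (u^~ (g j))}.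
    apply: (@choice _ _ (fun j s => covers s (u^~ (g j)))) => j.
    have [t] := bas.2 (g j).
    by exists t.
  exists (undup (flatten [seq t j | j : 'I_n])) => j.
  apply: (coversW (tP j)); rewrite ?undup_uniq // => i it.
  rewrite mem_undup; apply/flatten_mapP; exists j => //.
  by rewrite mem_enum.
(* Over an empty set of generators, [sP] says nothing about [s]. *)
case: n => [|n] in g gP sP *.
  exists [::], u; split=> [|v]; first exact: bas.1.
  by have [a ->] := gP v; rewrite !(big_ord0, big_nil).
exists s, u; split=> [|v]; first exact: bas.1.
apply: (dual_basis_sum bas); split=> [|i si]; first exact: (sP ord0).1.
have [a ->] := gP v; rewrite (lin_sum _ _ (bas.1 i)) big1 // => j _.
by rewrite (linZ (bas.1 i)) (sP j).2 // scaler0.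
Qed.

End DualBasis.

(** * Contractions of tensors and coextension of functionals *)

Section Contraction.
Variables (R : pzRingType) (M : lmodType R^c) (X : lmodType R).

Definition lcontr (xi : M -> R) : tensor M X -> X :=
  tlift (fun m x => xi m *: x).

Definition rcontr (eta : X -> R) : tensor M X -> M :=
  tlift (fun m x => m <* eta x).

(** Since [lcontr] is by definition a sum over a representative of the tensor,
    it is termwise additive in the form. *)
Lemma lcontr0 z : lcontr 0 z = 0.
Proof. by rewrite /lcontr /tlift big1 // => p _; exact: scale0r. Qed.

Lemma lcontr_formD (xi xi' : M -> R) z :
  lcontr (xi + xi') z = lcontr xi z + lcontr xi' z.
Proof.
by rewrite /lcontr /tlift -big_split; apply: eq_bigr => p _; exact: scalerDl.
Qed.

Section Left.
Variable xi : M -> R.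
Hypothesis xil : linear (xi : M -> R^c^o).

Lemma rlinear_mul m r : xi (m <* r) = xi m * r.
Proof. exact: (linR xil). Qed.

Lemma lcontr_balanced : balanced (fun m (x : X) => xi m *: x).
Proof.
split=> [m m' x|m x y|m r x]; last by rewrite rlinear_mul scalerA.
  by rewrite -scalerDl; congr (_ *: _); exact: (linD xil).
exact: scalerDr.
Qed.

Lemma lcontr_pure m x : lcontr xi (tpure M X m x) = xi m *: x.
Proof. exact: tlift_pure lcontr_balanced _ _. Qed.

Lemma lcontrD : {morph lcontr xi : y z / y + z}.
Proof. exact: tliftD lcontr_balanced. Qed.

End Left.

Section Right.
Variable eta : X -> R.
Hypothesis etal : linear (eta : X -> R^o).

Lemma llinear_mul r x : eta (r *: x) = r * eta x.
Proof. exact: (linZ etal). Qed.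

Lemma rcontr_balanced : balanced (fun (m : M) x => m <* eta x).
Proof.
split=> [m m' x|m x y|m r x]; last by rewrite llinear_mul ractA.
  exact: ractDl.
by rewrite -ractDr; congr (_ <* _); exact: (linD etal).
Qed.

Lemma rcontr_pure m x : rcontr eta (tpure M X m x) = m <* eta x.
Proof. exact: tlift_pure rcontr_balanced _ _. Qed.

Lemma rcontrD : {morph rcontr eta : y z / y + z}.
Proof. exact: tliftD rcontr_balanced. Qed.

End Right.

End Contraction.

Lemma tensor0l (R : pzRingType) (M : lmodType R^c) (X : lmodType R) (x : X) :
  tpure M X 0 x = 0.
Proof. by apply: (addrI (tpure M X 0 x)); rewrite -tpureDl !addr0. Qed.

Lemma tensor0r (R : pzRingType) (M : lmodType R^c) (X : lmodType R) (m : M) :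
  tpure M X m 0 = 0.
Proof. by apply: (addrI (tpure M X m 0)); rewrite -tpureDr !addr0. Qed.

Lemma additive0 (U V : zmodType) (f : U -> V) :
  {morph f : x y / x + y} -> f 0 = 0.
Proof. by move=> fD; apply: (addrI (f 0)); rewrite -fD !addr0. Qed.

Lemma tpure_sumr (R : pzRingType) (M : lmodType R^c) (X : lmodType R) (m : M)
    (I : Type) (s : seq I) (F : I -> X) :
  tpure M X m (\sum_(i <- s) F i) = \sum_(i <- s) tpure M X m (F i).
Proof. by apply: big_morph; [exact: tpureDr | exact: tensor0r]. Qed.

Lemma tmap_comp (R : pzRingType) (M1 M2 M3 : lmodType R^c)
    (N1 N2 N3 : lmodType R) (f : M1 -> M2) (f' : M2 -> M3)
    (g : N1 -> N2) (g' : N2 -> N3) (z : tensor M1 N1) :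
    linear f -> linear f' -> linear g -> linear g' ->
  tmap f' g' (tmap f g z) = tmap (f' \o f) (g' \o g) z.
Proof.
move=> fl fl' gl gl'.
have cfl : linear (f' \o f) by move=> a u v; rewrite /= fl fl'.
have cgl : linear (g' \o g) by move=> a u v; rewrite /= gl gl'.
elim/tensor_ind: z => [m n|x y IHx IHy]; first by rewrite !tmap_pure.
by rewrite !tmapD // IHx IHy.
Qed.

Section ColinearFunctionals.
Variables (k : comPzRingType) (A : kalgebra k) (C : coring A) (M : rcomod C).

Lemma eps_linear : linear (@eps _ _ C : C -> A^o).
Proof. exact: (eps_bimod_map C).1. Qed.

Lemma eps_ract (c : C) (a : A) : (eps (bract c a) : A) = (eps c : A) * a.
Proof. exact: (eps_bimod_map C).2. Qed.

Lemma eps_rlinear : linear (@eps _ _ C : rmod C -> A^c^o).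
Proof.
move=> a c d; rewrite -[LHS]/(eps (bract (c : C) a + d) : A).
by rewrite (linD eps_linear) eps_ract.
Qed.

Lemma rcontr_eps (m : M) : rcontr (@eps _ _ C) (rcoact m) = m.
Proof. exact: rcoact_counit. Qed.

Lemma lcontr_eps (c : C) : lcontr (M := rmod C) (@eps _ _ C) (delta c) = c.
Proof. exact: delta_counitl. Qed.

Section Extension.
Variable xi : M -> A.
Hypothesis xil : linear (xi : M -> A^c^o).

(** The colinear map [m |-> xi(m0) m1] corresponding to [xi] under
    [Hom^C(M, C) ~ Hom_A(M, A)]; the inverse is composition with the counit
    ([eps_coext] and [coext_eps]). *)
Definition coext (m : M) : rcoring C := lcontr xi (rcoact m).

Lemma lcontr_rlinear : linear (lcontr xi : rtensor M C -> rmod C).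
Proof.
apply: rtensor_linear => [|m c a]; first exact: lcontrD.
by rewrite !lcontr_pure // -bractZ.
Qed.

Lemma coext_linear : linear coext.
Proof. by move=> a u v; rewrite /coext rcoact_linear lcontr_rlinear. Qed.

(** Apply [xi] to the first tensor factor of the coassociativity identity. *)
Lemma coext_colinear : rcolinear coext.
Proof.
split=> [|m]; first exact: coext_linear.
have il : linear (@idfun C) by []; have iM : linear (@idfun M) by [].
have rl := @rcoact_linear _ _ _ M.
have dl := (delta_bimod_map C).1.
transitivity (lcontr xi (tmap (N' := ltensor C C) id (@delta _ _ C) (rcoact m))).
  rewrite /coext -[LHS]/(delta (lcontr xi (rcoact m))).
  elim/tensor_ind: (rcoact m) => [n c|x y IHx IHy].
    by rewrite (tmap_pure iM dl) !lcontr_pure // (linZ dl).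
  by rewrite (tmapD iM dl) !lcontrD // -IHx -IHy (linD dl).
rewrite -rcoact_coassoc.
rewrite -[RHS](tmap_comp (f := @rcoact _ _ _ M)
  (f' := lcontr xi : rtensor M C -> rmod C)
  (g := @idfun C) (g' := @idfun C)) //; last exact: lcontr_rlinear.
elim/tensor_ind: (tmap _ _ _) => [n c|x y IHx IHy]; last first.
  by rewrite tassocD lcontrD // (tmapD lcontr_rlinear il) IHx IHy.
rewrite (tmap_pure lcontr_rlinear il).
elim/tensor_ind: n => [n d|x y IHx IHy]; last first.
  rewrite (tpureDl (M := rtensor M C)) tassocD lcontrD // IHx IHy.
  rewrite -(tpureDl (M := rmod C)); congr tpure.
  exact: esym (lcontrD xil _ _).
by rewrite tassoc_pure !lcontr_pure // -ltensor_pure.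
Qed.

Lemma eps_coext m : eps (coext m : C) = xi m.
Proof.
rewrite -{2}(rcontr_eps m) /coext; have el := eps_linear.
elim/tensor_ind: (rcoact m) => [n c|x y IHx IHy].
  by rewrite lcontr_pure // rcontr_pure // (rlinear_mul xil) (llinear_mul el).
rewrite lcontrD // rcontrD // (linD el) IHx IHy.
by symmetry; exact: (linD xil).
Qed.

End Extension.

(** Colinearity gives [f(m)_1 (x) f(m)_2 = f(m0) (x) m1]; contract it with the
    counit. *)
Lemma coext_eps (f : M -> rcoring C) (m : M) :
  rcolinear f -> coext (fun n => eps (f n : C)) m = f m.
Proof.
move=> [fl fc]; rewrite -[RHS](lcontr_eps (f m)) -[delta _]/(rcoact (f m)) fc.
have il : linear (@idfun C) by []; have er := eps_rlinear.
have efl : linear ((fun n => eps (f n : C)) : M -> A^c^o).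
  by move=> a u v; rewrite fl er.
rewrite /coext; elim/tensor_ind: (rcoact m) => [n c|x y IHx IHy].
  by rewrite (tmap_pure fl il) !lcontr_pure.
by rewrite (tmapD fl il) !lcontrD // IHx IHy.
Qed.

End ColinearFunctionals.

(** * The evaluation map Hom(M, N) (x)_S M -> N *)

Section HomEval.
Variables (k : comPzRingType) (A : kalgebra k) (C : coring A) (M N : rcomod C).

Local Notation HM := (hom_tensor M N).
Local Notation pureHM := (tpure (rhom_mod M N) (endbimod M)).

Lemma pureHM_linear (p : rhom M N) : linear (pureHM p : M -> HM).
Proof.
move=> a u v; rewrite tpureDr; congr (_ + _).
by rewrite -[RHS]/((pureHM p u : rtensor _ _) <* (a : A)) rtensor_pure.
Qed.

Lemma hom_tensor_coact_pure (p : rhom M N) (m : M) :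
  hom_tensor_coact (pureHM p m)
    = tmap (M' := HM) (N := C) (pureHM p) id (rcoact m).
Proof.
have il : linear (@idfun C) by []; have pl := pureHM_linear.
apply: (tlift_pure (f := fun (p : rhom_mod M N) (m : endbimod M) =>
  tmap (M' := HM) (N := C) (pureHM p) id (rcoact (m : M)) : tensor HM C)).
split=> [q r n|q n n'|q s n].
- elim/tensor_ind: (rcoact _) => [n0 c|x y IHx IHy].
    rewrite !(tmap_pure (pl _) il) -(tpureDl (M := HM)).
    by congr tpure; exact: tpureDl.
  by rewrite !(tmapD (pl _) il) IHx IHy addrACA.
- rewrite -(tmapD (pl q) il); congr tmap.
  exact: (linD (@rcoact_linear _ _ _ M)).
- rewrite -[s *: n]/((s : rhom M M) (n : M)) (rhomP _).2.
  rewrite (_ : pureHM (q <* s) = pureHM q \o (s : rhom M M)).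
    by symmetry; apply: tmap_comp => //; exact: (rhomP s).1.
  by apply: funext => n'; exact: tpureZ.
Qed.

Lemma hom_eval_pure (p : rhom M N) (m : M) : hom_eval (pureHM p m : HM) = p m.
Proof. exact: tlift_pure (hom_eval_balanced M N) _ _. Qed.

Lemma hom_evalD : {morph (@hom_eval _ _ _ M N) : x y / x + y}.
Proof. exact: tliftD (hom_eval_balanced M N). Qed.

Lemma hom_eval_colinear : rcolinear (@hom_eval _ _ _ M N).
Proof.
have il : linear (@idfun C) by [].
have el : linear (@hom_eval _ _ _ M N).
  apply: rtensor_linear => [x y|p m a]; first exact: hom_evalD.
  by rewrite !hom_eval_pure; exact: (linR (rhomP p).1).
split=> // x; elim/tensor_ind: x => [p m|x y IHx IHy].
  rewrite hom_eval_pure (rhomP p).2 -[rcoact (_ : HM)]/(hom_tensor_coact _).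
  rewrite hom_tensor_coact_pure; symmetry.
  rewrite (_ : (p : M -> N) = @hom_eval _ _ _ M N \o pureHM p).
    by apply: tmap_comp => //; exact: pureHM_linear.
  by apply: funext => n; rewrite /= hom_eval_pure.
rewrite (linD el) (linD (@rcoact_linear _ _ _ N)) IHx IHy.
by rewrite (linD (@rcoact_linear _ _ _ HM)) (tmapD el il).
Qed.


End HomEval.

(** * A left colinear section makes a comodule principal *)

Section Criterion.
Variables (k : comPzRingType) (A : kalgebra k) (C : coring A) (M : rcomod C).

(** These are the components [w i : C -> M^*] of a left colinear section
    [C -> (M^* )^(I)] of the map [(xi_i)_i |-> sum_i xi_i(e_i0) e_i1].  The left
    coaction of [M^*] sends [xi] to the [xi_1 (x) xi_0] in [C (x)_A M^*] with
    [xi_1 xi_0(m) = xi(m0) m1] for all [m], which is why the third condition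
    [c1 w_i(c2)(m) = w_i(c)(m0) m1] expresses colinearity. *)
Definition left_section (I : eqType) (e : I -> M) (w : I -> C -> M -> A) :
    Prop :=
  [/\ forall i c, linear (w i c : M -> A^c^o),
      forall i m, linear ((w i)^~ m : C -> A^o),
      forall i c m,
        rcontr (M := rmod C) ((w i)^~ m) (delta c) = lcontr (w i c) (rcoact m) &
      forall c, exists2 s, covers s (fun i => w i c : M -> A) &
        \sum_(i <- s) lcontr (w i c) (rcoact (e i)) = c].

Lemma rcontr_llinear (eta : C -> A) :
  linear (eta : C -> A^o) ->
  linear (rcontr (M := rmod C) eta : ltensor C C -> C).
Proof.
move=> el; apply: ltensor_linear => [|r c d]; first exact: rcontrD.
by rewrite !rcontr_pure //; exact: bractZ.
Qed.

(** Coassociativity again: the coaction of [m0 eta(m1)] is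
    [m0 (x) m1 eta(m2)]. *)
Lemma rcoact_rcontr (eta : C -> A) (m : M) : linear (eta : C -> A^o) ->
  rcoact (rcontr eta (rcoact m))
    = tmap (N := C) (N' := C) id
        (fun c => rcontr (M := rmod C) eta (delta c)) (rcoact m).
Proof.
move=> el; have rl := @rcoact_linear _ _ _ M.
have il : linear (@idfun C) by []; have iM : linear (@idfun M) by [].
have dl := (delta_bimod_map C).1; have cl := rcontr_llinear el.
transitivity (tmap (N := ltensor C C) (N' := C) id (rcontr (M := rmod C) eta)
    (tassoc M C C (tmap (N := C) (@rcoact _ _ _ M) id (rcoact m)))); last first.
  by rewrite rcoact_coassoc; apply: tmap_comp.
elim/tensor_ind: (rcoact m) => [n c|x y IHx IHy]; last first.
  by rewrite (tmapD rl il) tassocD (tmapD iM cl) rcontrD // (linD rl) IHx IHy.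
rewrite (tmap_pure rl il) rcontr_pure // (linR rl).
elim/tensor_ind: (rcoact n) => [p d|x y IHx IHy].
  by rewrite tassoc_pure (tmap_pure iM cl) rcontr_pure // rtensor_pure.
rewrite (tpureDl (M := rtensor M C)) tassocD (tmapD iM cl) -IHx -IHy.
exact: (ractDl (M := rtensor M C)).
Qed.

Section Transport.
Variables (I : eqType) (e : I -> M) (w : I -> C -> M -> A).
Hypothesis sec : left_section e w.

Let wrl i c : linear (w i c : M -> A^c^o). Proof. by case: sec. Qed.
Let wll i m : linear ((w i)^~ m : C -> A^o). Proof. by case: sec. Qed.
Let w_colinear i c m :
  rcontr (M := rmod C) ((w i)^~ m) (delta c) = coext (w i c) m.
Proof. by case: sec. Qed.

Definition section_act (i : I) (z : tensor M C) (n : M) : M :=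
  rcontr ((w i)^~ n) z.

Lemma section_act_pure i m c n : section_act i (tpure M C m c) n = m <* w i c n.
Proof. exact: rcontr_pure. Qed.

Lemma section_actD i y z n :
  section_act i (y + z) n = section_act i y n + section_act i z n.
Proof. exact: rcontrD. Qed.

Lemma section_act_linear i z : linear (section_act i z).
Proof.
move=> a u v; elim/tensor_ind: z => [m c|x y IHx IHy]; last first.
  by rewrite !section_actD IHx IHy scalerDr addrACA.
rewrite !section_act_pure (linD (wrl i c)) (linZ (wrl i c)) ractDr; congr (_ + _).
by rewrite -[LHS]/(m <* (w i c u * (a : A))) -ractA.
Qed.

(** The coaction of [m0 w_i(m1)(n)] is [m0 (x) m1 w_i(m2)(n)], which the
    colinearity of [w i] turns into [m0 (x) w_i(m1)(n0) n1]. *)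
Lemma section_act_colinear i m : rcolinear (section_act i (rcoact m)).
Proof.
have il : linear (@idfun C) by []; have iM : linear (@idfun M) by [].
split=> [|n]; first exact: section_act_linear.
rewrite rcoact_rcontr //.
rewrite (_ : (fun c => _) = fun c => coext (w i c) n); last first.
  by apply: funext => c; exact: w_colinear.
have cl : linear (fun c => coext (w i c) n : C).
  move=> a c d; rewrite -!w_colinear; have [dl _] := delta_bimod_map C.
  by rewrite dl (rcontr_llinear (wll i n)).
elim/tensor_ind: (rcoact m) => [p c|x y IHx IHy]; last first.
  rewrite (tmapD iM cl) IHx IHy.
  elim/tensor_ind: (rcoact n) => [q d|u v IHu IHv].
    by rewrite !(tmap_pure (section_act_linear _ _) il) -tpureDl section_actD.
  by rewrite !(tmapD (section_act_linear _ _) il) -IHu -IHv addrACA.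
rewrite (tmap_pure iM cl) /coext.
elim/tensor_ind: (rcoact n) => [q d|u v IHu IHv].
  rewrite (tmap_pure (section_act_linear _ _) il) lcontr_pure //.
  by rewrite -tpureZ section_act_pure.
by rewrite (tmapD (section_act_linear _ _) il) lcontrD // tpureDr IHu IHv.
Qed.

Definition section_end (i : I) (m : M) : rend M :=
  mk_rhom (section_act_colinear i m).

(** An endomorphism [s] is colinear, so the coaction of [s m] is
    [s m0 (x) m1]. *)
Lemma section_end_linear i : linear (section_end i : endmod M -> (rend M)^o).
Proof.
have rl := @rcoact_linear _ _ _ M; have il : linear (@idfun C) by [].
move=> s u v; apply: rhom_inj => n.
rewrite -[LHS]/(section_act i (rcoact ((s : rhom M M) (u : M) + (v : M))) n).
rewrite (linD rl) section_actD; congr (_ + _).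
rewrite -[RHS]/((s : rhom M M) (section_act i (rcoact (u : M)) n)) (rhomP s).2.
have sl := (rhomP s).1.
elim/tensor_ind: (rcoact _) => [p c|x y IHx IHy].
  by rewrite (tmap_pure sl il) !section_act_pure (linR sl).
by rewrite (tmapD sl il) !section_actD IHx IHy (linD sl).
Qed.

(** Apply the counit to [sum_i w_i(c)(e_i0) e_i1 = c]. *)
Lemma section_eps c s : covers s (fun i => w i c : M -> A) ->
  \sum_(i <- s) w i c (e i) = eps c.
Proof.
move=> cs; have [_ _ _ /(_ c)[t ct sumt]] := sec.
have -> : \sum_(i <- s) w i c (e i) = \sum_(i <- t) w i c (e i).
  pose h i (f : M -> A) := f (e i); have h0 i : h i 0 = 0 by [].
  exact: covers_sum (covers_comp h0 cs) (covers_comp h0 ct).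
rewrite -[in RHS]sumt (lin_sum _ _ (@eps_linear _ _ C)).
by apply: eq_bigr => i _; symmetry; exact: (eps_coext (wrl i c)).
Qed.

Lemma section_act_sum (z : tensor M C) : exists2 s,
    covers s (fun i => section_act i z : M -> M) &
    \sum_(i <- s) section_act i z (e i) = rcontr (@eps _ _ C) z.
Proof.
have el := @eps_linear _ _ C.
elim/tensor_ind: z => [m c|x y [s cs sumx] [t ct sumy]].
  have [_ _ _ /(_ c)[s cs _]] := sec; exists s.
    split=> [|i si]; first exact: cs.1.
    apply: funext => n; rewrite section_act_pure (cs.2 i si).
    exact: (@scale0r _ M).
  rewrite rcontr_pure // -(section_eps cs).
  rewrite -[RHS]/(((\sum_(i <- s) w i c (e i) : A) : A^c) *: m).
  rewrite (@scaler_suml _ M); apply: eq_bigr => i _.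
  exact: section_act_pure.
have wD i :
    section_act i (x + y) = (section_act i x : M -> M) + section_act i y.
  by apply: funext => n; exact: section_actD.
have hD i : {morph (fun f : M -> M => f (e i)) : f g / f + g} by [].
have [r cr sumr] := covers_add hD cs ct; exists r.
  by split=> [|i ri]; [exact: cr.1 | rewrite wD; exact: cr.2].
rewrite rcontrD // -sumx -sumy -[RHS]sumr.
by apply: eq_bigr => i _; rewrite wD.
Qed.

(** This is where projectivity over the endomorphism ring comes from: by
    [section_eps], [sum_i m0 w_i(m1)(e_i) = m0 eps(m1) = m]. *)
Lemma left_section_dual_basis :
  dual_basis (e : I -> endmod M) (fun i => section_end i).
Proof.
split=> [i|m]; first exact: section_end_linear.
have [s [us sx] sumz] := section_act_sum (rcoact (m : M)); exists s.
  by split=> // i si; apply: rhom_inj => n; rewrite /= sx.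
by rewrite -[RHS](rcontr_eps (m : M)) -sumz.
Qed.

Local Notation HM := (hom_tensor M (rcoring C)).
Local Notation pureHM := (tpure (rhom_mod M (rcoring C)) (endbimod M)).

Definition coext_hom (i : I) (c : C) : rhom M (rcoring C) :=
  mk_rhom (coext_colinear (wrl i c)).

Lemma coext_homD i c d : coext_hom i (c + d) = coext_hom i c + coext_hom i d.
Proof.
apply: rhom_inj => m; rewrite -[LHS]/(coext (w i (c + d)) m) -w_colinear.
rewrite -[RHS]/(coext (w i c) m + coext (w i d) m) -!w_colinear.
have [dl _] := delta_bimod_map C.
by rewrite (linD dl) rcontrD.
Qed.

(** The identity that makes the evaluation injective: both sides send [n] to
    [f(m0) w_i(m1)(n)]. *)
Lemma coext_hom_eval i (f : rhom M (rcoring C)) m :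
  coext_hom i (f m) = rhom_comp f (section_end i m).
Proof.
apply: rhom_inj => n; have il : linear (@idfun C) by [].
rewrite -[LHS]/(coext (w i (f m)) n) -w_colinear -[delta _]/(rcoact (f m)).
have fl := (rhomP f).1.
rewrite (rhomP f).2 -[RHS]/(f (section_act i (rcoact m) n)).
elim/tensor_ind: (rcoact m) => [p c|x y IHx IHy].
  by rewrite (tmap_pure fl il) rcontr_pure // section_act_pure (linR fl).
by rewrite (tmapD fl il) rcontrD // IHx IHy section_actD (linD fl).
Qed.

(** The inverse of the evaluation is [c |-> sum_i coext(w_i(c)) (x) e_i].  It is
    a left inverse because
    [f (x) m = sum_i f (x) t_i(m) e_i = sum_i f t_i(m) (x) e_i], where the
    endomorphisms [t_i(m) = section_end i m] are the coordinates of [m] in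
    [left_section_dual_basis]. *)
Lemma left_section_galois : riso (@hom_eval _ _ _ M (rcoring C)).
Proof.
have hc := @hom_eval_colinear _ _ _ M (rcoring C); have hl := hc.1.
split=> //; have [_ _ _ complete] := sec.
have [supp suppP] : {supp : C -> seq I & forall c,
    covers (supp c) (fun i => w i c : M -> A) /\
    \sum_(i <- supp c) lcontr (w i c) (rcoact (e i)) = c}.
  apply: (@choice _ _ (fun c s => covers s (fun i => w i c : M -> A) /\
    \sum_(i <- s) lcontr (w i c) (rcoact (e i)) = c)) => c.
  by have [s] := complete c; exists s.
pose term c i : HM := pureHM (coext_hom i c) (e i).
pose g c : HM := \sum_(i <- supp c) term c i.
have coext0 i c : w i c = 0 :> (M -> A) -> coext_hom i c = 0.
  move=> w0; apply: rhom_inj => m; rewrite -[LHS]/(coext (w i c) m) w0.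
  exact: (lcontr0 (M := M) (X := C)).
have gE c s : covers s (fun i => coext_hom i c) -> g c = \sum_(i <- s) term c i.
  move=> cs; apply: covers_sum.
    split=> [|i si]; first exact: (suppP c).1.1.
    by rewrite /term coext0 ?tensor0l //; exact: (suppP c).1.2.
  pose h i (f : rhom M (rcoring C)) : HM := pureHM f (e i).
  by apply: (covers_comp (h := h)) cs => i; exact: tensor0l.
have coversc c : covers (supp c) (fun i => coext_hom i c).
  have [[us cs] _] := suppP c; split=> // i si.
  exact/coext0/cs.
have gD : {morph g : c d / c + d}.
  move=> c d; set s := undup (supp c ++ supp d).
  have cc := covers_catl (supp d) (coversc c).
  have cd := covers_catr (supp c) (coversc d).
  rewrite (gE c _ cc) (gE d _ cd) (gE (c + d) s).
    rewrite -big_split; apply: eq_bigr => i _.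
    by rewrite /term coext_homD; exact: tpureDl.
  split=> [|i si]; first exact: cc.1.
  by rewrite coext_homD (cc.2 i si) (cd.2 i si) addr0.
have gK : cancel g (@hom_eval _ _ _ M (rcoring C)).
  move=> c; rewrite /g (lin_sum _ _ hl) -[RHS](suppP c).2.
  by apply: eq_bigr => i _; rewrite /term hom_eval_pure.
have Kg : cancel (@hom_eval _ _ _ M (rcoring C)) g.
  elim/tensor_ind=> [f m|x y IHx IHy]; last by rewrite (linD hl) gD IHx IHy.
  rewrite hom_eval_pure.
  have [s cs summ] := left_section_dual_basis.2 m.
  rewrite (gE _ s); last first.
    split=> [|i si]; first exact: cs.1.
    rewrite coext_hom_eval (cs.2 i si); apply: rhom_inj => n.
    by rewrite -[LHS]/(f 0); exact: (lin0 (rhomP f).1).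
  rewrite -[in RHS]summ tpure_sumr; apply: eq_bigr => i _.
  by rewrite /term coext_hom_eval -tpureZ.
have gl : linear (g : rcoring C -> HM).
  move=> a c d; rewrite gD; congr (_ + _).
  by apply: (can_inj Kg); rewrite gK (linZ hl) gK.
exists g; split=> //; split=> // c.
have il : linear (@idfun C) by [].
rewrite -[in RHS](gK c) hc.2 (tmap_comp _ hl gl il il).
rewrite (_ : g \o _ = id); last by apply: funext => x; exact: Kg.
by elim/tensor_ind: (rcoact _) => [p d|x y IHx IHy];
  rewrite ?(tmap_pure (f := id)) // (tmapD (f := id)) // -IHx -IHy.
Qed.

End Transport.

Lemma principal_of_left_section (I : eqType) (e : I -> M) (w : I -> C -> M -> A) :
  finitely_generated M -> projective M -> left_section e w -> principal M.
Proof.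
move=> fgM projM sec; split; first by split=> //; exact: left_section_galois sec.
exact: dual_basis_projective (left_section_dual_basis sec).
Qed.

End Criterion.

(** * Principal comodules have left colinear sections *)

Lemma tensor_dual_basis (R : pzRingType) (M : lmodType R^c) (X : lmodType R)
    (s : seq M) (xi : M -> M -> R) (z : tensor M X) :
    finite_dual_basis s (xi : M -> M -> R^c) ->
  \sum_(y <- s) tpure M X y (lcontr (xi y) z) = z.
Proof.
move=> [xil xiP]; elim/tensor_ind: z => [m x|u v IHu IHv]; last first.
  rewrite -[in RHS]IHu -[in RHS]IHv -big_split; apply: eq_bigr => y _ /=.
  by rewrite (lcontrD (xil y)) tpureDr.
have tpl : {morph (fun n => tpure M X n x) : n n' / n + n'}.
  by move=> n n'; exact: tpureDl.
rewrite -[in RHS](xiP m) (big_morph _ tpl (@tensor0l _ M X x)).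
apply: eq_bigr => y _.
by rewrite (lcontr_pure (xil y)) -tpureZ.
Qed.

Section SectionOfPrincipal.
Variables (k : comPzRingType) (A : kalgebra k) (C : coring A) (M : rcomod C).

Local Notation HM := (hom_tensor M (rcoring C)).
Local Notation pureHM := (tpure (rhom_mod M (rcoring C)) (endbimod M)).
Local Notation ev := (@hom_eval _ _ _ M (rcoring C)).

Section Coefficients.
Variable u : M -> endmod M -> rend M.
Hypothesis ub : dual_basis (id : M -> endmod M) u.

(** [coef x] is [Hom^C(M, C) (x)_S u_x], where [u_x : M -> S] is the coordinate
    form at [x]. *)
Definition coef (x : M) : HM -> rhom M (rcoring C) :=
  tlift (fun (f : rhom_mod M (rcoring C)) (m : endbimod M) =>
    rhom_comp f (u x m)).

Let coef_balanced x :
  balanced (fun (f : rhom_mod M (rcoring C)) (m : endbimod M) =>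
    rhom_comp f (u x m)).
Proof.
have ul := ub.1 x; split=> [f g m|f m n|f s m]; apply: rhom_inj => p //.
  rewrite -[LHS]/(f (u x (m + n) p)) (linD ul).
  by exact: (linD (rhomP (f : rhom M (rcoring C))).1).
by rewrite -[RHS]/(f (u x (s *: m) p)) (linZ ul).
Qed.

Lemma coef_pure x (f : rhom M (rcoring C)) (m : M) :
  coef x (pureHM f m) = rhom_comp f (u x m).
Proof. exact: tlift_pure (coef_balanced x) _ _. Qed.

Lemma coefD x : {morph coef x : y z / y + z}.
Proof. exact: tliftD (coef_balanced x). Qed.

Lemma coef_sum (z : HM) : exists2 s, covers s (coef^~ z) &
  \sum_(x <- s) coef x z x = ev z.
Proof.
elim/tensor_ind: z => [f m|y z [s cs sumy] [t ct sumz]].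
  have [s cs summ] := ub.2 m; exists s.
    split=> [|x sx]; first exact: cs.1.
    rewrite coef_pure (cs.2 x sx); apply: rhom_inj => n.
    exact: (lin0 (rhomP f).1).
  rewrite hom_eval_pure -[in RHS]summ (lin_sum _ _ (rhomP f).1).
  by apply: eq_bigr => x _; rewrite coef_pure.
have hD x : {morph (fun f : rhom M (rcoring C) => f x) : f g / f + g} by [].
have [r cr sumr] := covers_add hD cs ct; exists r.
  by split=> [|x rx]; [exact: cr.1 | rewrite coefD; exact: cr.2].
rewrite hom_evalD -sumy -sumz -[RHS]sumr.
by apply: eq_bigr => x _; rewrite coefD.
Qed.

Lemma scale_rhom (a : A) (f : rhom M (rcoring C)) :
  rcolinear (fun m => a *: (f m : C) : rcoring C).
Proof.
have [fl fc] := rhomP f; have il : linear (@idfun C) by [].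
have [dl _] := delta_bimod_map C.
have afl : linear (fun m => a *: (f m : C) : rcoring C).
  move=> b m n; rewrite -[b *: m]/(m <* (b : A)) (linD fl) (linR fl).
  rewrite -[_ <* _ + _]/(bract (f m : C) b + (f n : C)) scalerDr -bractZ.
  by [].
split=> // m; rewrite -[LHS]/(delta (a *: (f m : C))) (linZ dl).
rewrite -[delta _]/(rcoact (f m)) fc.
elim/tensor_ind: (rcoact m) => [n c|x y IHx IHy].
  by rewrite !tmap_pure // ltensor_pure.
by rewrite !tmapD // -IHx -IHy; exact: (@scalerDr _ (ltensor C C)).
Qed.

(** Left linearity of [coef x], expressed through the images in [C] because
    [HM] only carries a right action. *)
Lemma coefZ (a : A) (z : HM) : exists2 z' : HM, ev z' = a *: (ev z : C) &
  forall x m, coef x z' m = a *: (coef x z m : C).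
Proof.
elim/tensor_ind: z => [f m|y z [y' yE yC] [z' zE zC]].
  exists (pureHM (mk_rhom (scale_rhom a f)) m); first by rewrite !hom_eval_pure.
  by move=> x n; rewrite !coef_pure.
exists (y' + z').
  by rewrite !hom_evalD yE zE; exact: esym (@scalerDr _ C a _ _).
move=> x m; rewrite !coefD -[LHS]/(coef x y' m + coef x z' m) yC zC.
exact: esym (@scalerDr _ C a _ _).
Qed.

Variable g : rcoring C -> HM.
Hypotheses (gK : cancel g ev) (Kg : cancel ev g).

Let gD : {morph g : c d / c + d}.
Proof. by move=> c d; apply: (can_inj Kg); rewrite hom_evalD !gK. Qed.

(** The section of the evaluation map: [g] identifies [C] with
    [Hom^C(M, C) (x)_S M], to which the coordinates over [S] are applied. *)
Definition coef_form (x : M) (c : C) (m : M) : A := eps (coef x (g c) m : C).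

Lemma coef_form_rlinear x c : linear (coef_form x c : M -> A^c^o).
Proof.
by move=> a m n; rewrite /coef_form (rhomP _).1; exact: eps_rlinear.
Qed.

Lemma coef_form_llinear x m : linear ((coef_form x)^~ m : C -> A^o).
Proof.
have el := @eps_linear _ _ C; move=> a c d; rewrite /coef_form gD coefD.
rewrite -[LHS]/(eps (coef x (g (a *: c)) m + coef x (g d) m : C)).
have -> : coef x (g (a *: c)) m = a *: (coef x (g c) m : C).
  have [z zE zC] := coefZ a (g c).
  by rewrite -zC -[in LHS](gK c) -zE Kg.
exact: el.
Qed.

Variables (s : seq M) (xi : M -> M -> A).
Hypothesis xib : finite_dual_basis s (xi : M -> M -> A^c).

(** Take [c = f(n)].  The right-hand side is [f(u_x(n) m)].  On the left, the
    coproduct of [c] is [f(n0) (x) n1], where [n1] need not be a value of a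
    colinear map; expanding [n0 (x) n1] along a dual basis of [M] over [A] as
    [sum_y y (x) xi_y(n0) n1] cures this, since [xi_y(n0) n1] is the value at
    [n] of the colinear map [coext (xi y)].  The contraction then becomes
    [sum_y f(y) xi_y(u_x(n) m) = f(u_x(n) m)]. *)
Lemma coef_form_colinear x c m :
  rcontr (M := rmod C) ((coef_form x)^~ m) (delta c)
    = lcontr (coef_form x c) (rcoact m).
Proof.
have wl := coef_form_llinear x m; have il : linear (@idfun C) by [].
rewrite -[RHS]/(coext (fun n => eps (coef x (g c) n : C)) m).
rewrite coext_eps; last exact: rhomP.
rewrite -{1}(gK c).
elim/tensor_ind: (g c) => [f n|y z IHy IHz]; last first.
  rewrite hom_evalD coefD (linD (delta_bimod_map C).1) rcontrD // IHy IHz.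
  by [].
rewrite hom_eval_pure coef_pure -[delta _]/(rcoact (f n)) (rhomP f).2.
have fl := (rhomP f).1.
rewrite -(tensor_dual_basis (rcoact n) xib).
rewrite (big_morph (tmap (N := C) f id) (tmapD fl il) (additive0 (tmapD fl il))).
rewrite (big_morph _ (rcontrD wl) (additive0 (rcontrD wl))).
rewrite -[RHS]/(f (u x n m)) -[in RHS](xib.2 (u x n m)) (lin_sum _ _ fl).
apply: eq_bigr => y _; rewrite (tmap_pure fl il) rcontr_pure //.
have xiy := xib.1 y.
rewrite -[lcontr _ _]/(coext (xi y) n) -[RHS]/(f (y <* (xi y (u x n m) : A))).
rewrite (linR fl); congr (_ <* _); rewrite /coef_form.
have -> : coext (xi y) n = ev (pureHM (mk_rhom (coext_colinear xiy)) n).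
  by rewrite hom_eval_pure.
by rewrite Kg coef_pure; exact: (eps_coext xiy).
Qed.

Lemma coef_form_section : left_section (id : M -> M) coef_form.
Proof.
split; [exact: coef_form_rlinear | exact: coef_form_llinear
       | exact: coef_form_colinear | move=> c].
have [t ct sumt] := coef_sum (g c); exists t.
  split=> [|x tx]; first exact: ct.1.
  apply: funext => m; rewrite /coef_form (ct.2 x tx).
  exact: (lin0 (@eps_linear _ _ C)).
rewrite -[RHS](gK c) -sumt; apply: eq_bigr => x _.
by rewrite -(coext_eps _ (rhomP _)).
Qed.

End Coefficients.

(** The elements of [M] themselves serve as the family [e]. *)
Lemma left_section_of_principal :
  principal M -> exists w : M -> C -> M -> A, left_section id w.
Proof.
case=> [[fgM projM [_ [g [_ Kg gK]]]] /projective_dual_basis[u ub]].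
have [s [xi xib]] := fg_projective_dual_basis fgM projM.
by exists (coef_form u g); exact: coef_form_section xib.
Qed.

End SectionOfPrincipal.

(** * Base change along a morphism of corings *)

Section BaseChangeDualBasis.
Variables (A B : pzRingType) (alpha : {rmorphism A -> B}) (M : lmodType A^c).

Local Notation Bm := (lrestr alpha (regular B)).
Local Notation MB := (rtensor M Bm).

Lemma base_change_pure m (b : B) :
  (tpure M Bm m (1 : B) : MB) <* b = tpure M Bm m b.
Proof. by rewrite rtensor_pure; congr tpure; exact: mul1r. Qed.

Lemma base_change_ract m (a : A) :
  tpure M Bm (m <* a) (1 : B) = (tpure M Bm m (1 : B) : MB) <* alpha a.
Proof. by rewrite base_change_pure tpureZ; congr tpure; exact: mulr1. Qed.

(** The extension of [xi] to [M (x)_A B]; it corresponds to [1 (x) xi] under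
    [B (x)_A M^* ~ (M (x)_A B)^*]. *)
Definition base_form (xi : M -> A) : MB -> B :=
  tlift (fun (m : M) (b : Bm) => alpha (xi m) * (b : B)).

Lemma base_form0 : base_form 0 = 0.
Proof.
apply: funext => x; rewrite /base_form /tlift big1 // => p _.
by rewrite -[LHS]/(alpha 0 * _) rmorph0 mul0r.
Qed.

Section Form.
Variable xi : M -> A.
Hypothesis xil : linear (xi : M -> A^c^o).

Let balanced_form : balanced (fun (m : M) (b : Bm) => alpha (xi m) * (b : B)).
Proof.
split=> [m n b|m b b'|m a b]; last by rewrite (rlinear_mul xil) rmorphM mulrA.
  rewrite (linD xil) -[LHS]/(alpha ((xi m : A) + xi n) * (b : B)).
  by rewrite rmorphD mulrDl.
exact: mulrDr.
Qed.

Lemma base_form_pure m (b : B) :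
  base_form xi (tpure M Bm m b) = alpha (xi m) * b.
Proof. exact: tlift_pure balanced_form _ _. Qed.

Lemma base_formD : {morph base_form xi : x y / x + y}.
Proof. exact: tliftD balanced_form. Qed.

Lemma base_form_linear : linear (base_form xi : MB -> B^c^o).
Proof.
apply: rtensor_linear => [|m b b']; first exact: base_formD.
rewrite base_form_pure -[RHS]/(base_form xi (tpure M Bm m b) * b').
by rewrite base_form_pure -mulrA.
Qed.

End Form.

Section FiniteDualBasis.
Variables (s : seq M) (xi : M -> M -> A).
Hypothesis xib : finite_dual_basis s (xi : M -> M -> A^c).

Lemma base_change_sum (x : MB) :
  \sum_(y <- s) (tpure M Bm y (1 : B) : MB) <* base_form (xi y) x = x.
Proof.
have [xil xiP] := xib.
have tpl b : {morph (fun n => tpure M Bm n b) : n n' / n + n'}.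
  by move=> n n'; exact: tpureDl.
elim/tensor_ind: x => [m b|u v IHu IHv]; last first.
  rewrite -[in RHS]IHu -[in RHS]IHv -big_split; apply: eq_bigr => y _ /=.
  by rewrite base_formD // (ractDr (M := MB)).
rewrite -[in RHS](xiP m) (big_morph _ (tpl b) (@tensor0l _ M Bm b)).
apply: eq_bigr => y _; rewrite base_form_pure // base_change_pure.
by rewrite -[_ *: _]/(y <* (xi y m : A)) tpureZ.
Qed.

Lemma base_change_fg : finitely_generated MB.
Proof.
exists (size s), (fun j => tpure M Bm (tnth (in_tuple s) j) (1 : B)) => x.
exists (fun j => base_form (xi (tnth (in_tuple s) j)) x).
by rewrite -[LHS]base_change_sum big_tnth.
Qed.

Lemma base_change_projective : projective MB.
Proof.
pose e j : MB := tpure M Bm (tnth (in_tuple s) j) (1 : B).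
pose u j : MB -> B^c := base_form (xi (tnth (in_tuple s) j)).
apply: (@dual_basis_projective _ MB 'I_(size s) e u).
split=> [j|x]; first exact: base_form_linear (xib.1 _).
exists (enum 'I_(size s)).
  by split=> [|j]; [exact: enum_uniq | rewrite mem_enum].
by rewrite big_enum -[RHS]base_change_sum [RHS]big_tnth.
Qed.

End FiniteDualBasis.

End BaseChangeDualBasis.

Section CoringBaseChange.
Variables (k : comPzRingType) (A B : kalgebra k) (C : coring A) (D : coring B).
Variable phi : coring_mor C D.
Local Notation alpha := (cm_alg phi).
Local Notation gamma c := (@cm_map _ _ _ _ _ phi c : D).

Lemma gammaD c d : gamma (c + d) = gamma c + gamma d.
Proof. exact: (linD (cm_bimod_map phi).1). Qed.

Lemma gammaZ a c : gamma (a *: c) = alpha a *: gamma c.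
Proof. exact: (linZ (cm_bimod_map phi).1). Qed.

Lemma gammaR c a : gamma (bract c a) = bract (gamma c) (alpha a).
Proof. exact: (cm_bimod_map phi).2. Qed.

Section InducedCoactions.
Variable M : rcomod C.

Local Notation Bm := (lrestr alpha (regular B)).
Local Notation MB := (rtensor M Bm).
Local Notation Br := (rrestr alpha (regular B)).
Local Notation BC := (ltensor Br C).

(** The inner sums of the two induced coactions, with the coaction of [M] and
    the coproduct of [C] replaced by arbitrary tensors so that identities can be
    checked on pure ones. *)
Definition rpush (b : B) (z : tensor M C) : rtensor MB D :=
  tlift (fun (m : M) (c : C) =>
    tpure MB D (tpure M Bm m (1 : B)) (bract (gamma c) b)) z.

Let rpush_balanced b : balanced (fun (m : M) (c : C) =>
  tpure MB D (tpure M Bm m (1 : B)) (bract (gamma c) b)).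
Proof.
split=> [m m' c|m c d|m a c].
- by rewrite -(tpureDl (M := MB)); congr tpure; exact: tpureDl.
- by rewrite gammaD bractDl tpureDr.
- by rewrite base_change_ract tpureZ gammaZ bractZ.
Qed.

Lemma rpush_pure b m c : rpush b (tpure M C m c)
  = tpure MB D (tpure M Bm m (1 : B)) (bract (gamma c) b).
Proof. exact: tlift_pure (rpush_balanced b) _ _. Qed.

Lemma rpushD b : {morph rpush b : x y / x + y}.
Proof. exact: tliftD (rpush_balanced b). Qed.

Lemma ind_rcoact_pure (m : M) (b : B) :
  ind_rcoact (phi := phi) (tpure M Bm m b) = rpush b (rcoact m).
Proof.
apply: (tlift_pure (f := fun (m : M) (b : Bm) => rpush (b : B) (rcoact m))).
split=> [n n' c|n c c'|n a c].
- by rewrite (linD (@rcoact_linear _ _ _ M)) rpushD.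
- elim/tensor_ind: (rcoact n) => [p d|x y IHx IHy].
    by rewrite !rpush_pure bractDr tpureDr.
  by rewrite !rpushD IHx IHy addrACA.
- rewrite (linR (@rcoact_linear _ _ _ M)).
  elim/tensor_ind: (rcoact n) => [p d|x y IHx IHy].
    by rewrite rtensor_pure !rpush_pure gammaR bractA.
  by rewrite (ractDl (M := rtensor M C)) !rpushD IHx IHy.
Qed.

Definition lpush (b : B) (z : ltensor C C) : ltensor D BC :=
  tlift (fun (c1 : rmod C) (c2 : C) =>
    tpure (rmod D) BC (b *: gamma c1) (tpure (rmod Br) C (1 : B) c2)) z.

Let lpush_balanced b : balanced (fun (c1 : rmod C) (c2 : C) =>
  tpure (rmod D) BC (b *: gamma c1) (tpure (rmod Br) C (1 : B) c2)).
Proof.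
split=> [c d e|c d e|c a d].
- rewrite -tpureDl; congr tpure.
  by rewrite -[RHS](@scalerDr B D) -gammaD.
- by rewrite -tpureDr; congr tpure; exact: tpureDr.
- rewrite -[c <* a]/(bract (c : C) a) gammaR -bractZ.
  rewrite -[bract _ _]/((b *: gamma c : rmod D) <* alpha a) tpureZ; congr tpure.
  rewrite ltensor_pure -tpureZ; congr tpure.
  by rewrite -[LHS]/(alpha a * 1) -[RHS]/(1 * alpha a) mulr1 mul1r.
Qed.

Lemma lpush_pure b c d : lpush b (tpure (rmod C) C c d)
  = tpure (rmod D) BC (b *: gamma c) (tpure (rmod Br) C (1 : B) d).
Proof. exact: tlift_pure (lpush_balanced b) _ _. Qed.

Lemma lpushD b : {morph lpush b : x y / x + y}.
Proof. exact: tliftD (lpush_balanced b). Qed.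

Lemma ind_lcoact_pure (b : B) (c : C) :
  @ind_lcoact _ _ _ _ _ phi (lcoring C) (tpure (rmod Br) C b c)
    = lpush b (delta c).
Proof.
have [dl _] := delta_bimod_map C.
apply: (tlift_pure (f := fun (b : rmod Br) (c : C) => lpush (b : B) (delta c))).
split=> [b' b'' d|b' d e|b' a d].
- elim/tensor_ind: (delta d) => [d1 d2|x y IHx IHy].
    by rewrite !lpush_pure scalerDl -tpureDl.
  by rewrite !lpushD IHx IHy addrACA.
- by rewrite (linD dl) lpushD.
- rewrite (linZ dl).
  elim/tensor_ind: (delta d) => [d1 d2|x y IHx IHy].
    rewrite ltensor_pure !lpush_pure gammaZ scalerA.
    by [].
  by rewrite (@scalerDr _ (ltensor C C)) !lpushD IHx IHy.
Qed.

Section Form.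
Variable w : C -> M -> A.
Hypotheses (wrl : forall c, linear (w c : M -> A^c^o))
           (wll : forall m, linear (w^~ m : C -> A^o)).

(** The map [B (x)_A C -> B (x)_A M^* ~ (M (x)_A B)^*] induced by [w]. *)
Definition pairing (n : MB) : BC -> B :=
  tlift (fun (b : rmod Br) (c : C) =>
    (b : B) * base_form (alpha := alpha) (w c) n).

Let base_form_linear_coef n :
  linear ((fun c => base_form (alpha := alpha) (w c) n)
          : C -> restr alpha B^o).
Proof.
move=> a c d; elim/tensor_ind: n => [m b|x y IHx IHy].
  rewrite !base_form_pure // wll.
  rewrite -[LHS]/(alpha (a * w c m + w d m) * b).
  by rewrite rmorphD rmorphM mulrDl -mulrA.
by rewrite !base_formD // IHx IHy scalerDr addrACA.
Qed.

Let pairing_balanced n : balanced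
  (fun (b : rmod Br) (c : C) => (b : B) * base_form (alpha := alpha) (w c) n).
Proof.
have fl := base_form_linear_coef n; split=> [b b' c|b c d|b a c].
- exact: mulrDl.
- by rewrite (linD fl) mulrDr.
- by rewrite (linZ fl) -[LHS]/(_ * alpha a * _) -mulrA.
Qed.

Lemma pairing_pure n (b : B) c :
  pairing n (tpure (rmod Br) C b c) = b * base_form (alpha := alpha) (w c) n.
Proof. exact: tlift_pure (pairing_balanced n) _ _. Qed.

Lemma pairingD n : {morph pairing n : x y / x + y}.
Proof. exact: tliftD (pairing_balanced n). Qed.

Lemma pairing_llinear n : linear (pairing n : BC -> B^o).
Proof.
apply: ltensor_linear => [|r b c]; first exact: pairingD.
by rewrite !pairing_pure -[RHS]/(r * (b * _)) mulrA.
Qed.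

Lemma pairing_rlinear y : linear ((fun n => pairing n y) : MB -> B^c^o).
Proof.
move=> b n n'; elim/tensor_ind: y => [b' c|x y IHx IHy].
  rewrite !pairing_pure (base_form_linear (wrl c)).
  rewrite -[LHS]/(b' * (base_form (w c) n * b + base_form (w c) n')).
  by rewrite mulrDr mulrA.
by rewrite !pairingD IHx IHy scalerDr addrACA.
Qed.

Lemma lcontr_rpush (b b' : B) (c : C) (z : tensor M C) :
  lcontr ((fun n => pairing n (tpure (rmod Br) C b' c)) : MB -> B) (rpush b z)
    = b' *: (bract (gamma (lcontr (w c) z)) b).
Proof.
have br := pairing_rlinear.
elim/tensor_ind: z => [n d|u v IHu IHv]; last first.
  rewrite rpushD !lcontrD // IHu IHv gammaD bractDl.
  exact: esym (@scalerDr _ D _ _ _).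
rewrite rpush_pure !lcontr_pure // pairing_pure base_form_pure // mulr1.
by rewrite gammaZ bractZ scalerA.
Qed.

Hypothesis w_colinear : forall c m,
  rcontr (M := rmod C) (w^~ m) (delta c) = lcontr (w c) (rcoact m).

(** On [y = b' (x) c] and [n = m (x) b] the two sides are
    [b' gamma(c1 w(c2)(m)) b] and [b' gamma(w(c)(m0) m1) b]. *)
Lemma pairing_colinear (y : BC) (n : MB) :
  rcontr (M := rmod D) (pairing n) (@ind_lcoact _ _ _ _ _ phi (lcoring C) y)
    = lcontr ((fun n => pairing n y) : MB -> B) (ind_rcoact (phi := phi) n).
Proof.
have bl := pairing_llinear; have br := pairing_rlinear.
have lcD := linD (@lcoact_linear _ _ _ (ind_lcomod phi (lcoring C))).
have rcD := linD (@rcoact_linear _ _ _ (ind_rcomod phi M)).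
elim/tensor_ind: n => [m b|n n' IHn IHn']; last first.
  rewrite [ind_rcoact _]rcD (lcontrD (br y)) -IHn -IHn'.
  elim/tensor_ind: (ind_lcoact _) => [d x|u v IHu IHv].
    rewrite !rcontr_pure // -[RHS](@ractDr _ (rmod D)).
    by congr (_ <* _); exact: (linD (br x)).
  by rewrite !rcontrD // IHu IHv addrACA.
elim/tensor_ind: y => [b' c|y y' IHy IHy']; last first.
  rewrite [ind_lcoact _]lcD (rcontrD (bl _)) IHy IHy'.
  elim/tensor_ind: (ind_rcoact _) => [n d|u v IHu IHv].
    by rewrite !lcontr_pure // pairingD scalerDl.
  by rewrite !lcontrD // -IHu -IHv addrACA.
rewrite ind_lcoact_pure ind_rcoact_pure.
transitivity ((b' : B) *:
    (bract (gamma (rcontr (M := rmod C) (w^~ m) (delta c))) b)).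
  elim/tensor_ind: (delta c) => [c1 c2|u v IHu IHv]; last first.
    rewrite lpushD !rcontrD // IHu IHv gammaD bractDl.
    exact: esym (@scalerDr _ D _ _ _).
  rewrite lpush_pure !rcontr_pure // pairing_pure base_form_pure // mul1r.
  rewrite -[(c1 : rmod C) <* _]/(bract (c1 : C) (w c2 m)) gammaR bractA.
  by rewrite -[LHS]/(bract ((b' : B) *: gamma c1) (alpha (w c2 m) * b)) bractZ.
by rewrite w_colinear lcontr_rpush.
Qed.

End Form.

Section SectionBaseChange.
Variable sigma : lcoring D -> ind_lcomod phi (lcoring C).
Hypotheses (sigma_colinear : lcolinear sigma)
           (sigmaK : cancel sigma (gamma_tilde phi)).
Variables (I : eqType) (e : I -> M) (w : I -> C -> M -> A).
Hypothesis sec : left_section e w.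

Let wrl i c : linear (w i c : M -> A^c^o). Proof. by case: sec. Qed.
Let wll i m : linear ((w i)^~ m : C -> A^o). Proof. by case: sec. Qed.

(** The value at [b (x) c] is [sum_i b gamma(w_i(c)(e_i0) e_i1)], which is
    [b gamma(c)] because [w] is a section. *)
Lemma pairing_sum (y : BC) : exists2 s,
    covers s (fun i => (fun n => pairing (w i) n y) : MB -> B) &
  \sum_(i <- s) lcontr ((fun n => pairing (w i) n y) : MB -> B)
     (rpush 1 (rcoact (e i))) = gamma_tilde phi y.
Proof.
have gD := tliftD (gamma_tilde_balanced phi).
have gp := tlift_pure (gamma_tilde_balanced phi).
have bp i n (b : B) c :
    pairing (w i) n (tpure (rmod Br) C b c) = b * base_form (w i c) n.
  exact: pairing_pure.
have bD i n : {morph pairing (w i) n : x y / x + y} by exact: pairingD.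
elim/tensor_ind: y => [b c|y z [s cs sumy] [t ct sumz]].
  have [_ _ _ /(_ c)[s cs sumc]] := sec; exists s.
    split=> [|i si]; first exact: cs.1.
    by apply: funext => n; rewrite bp (cs.2 i si) base_form0 mulr0.
  have scale_gamma : {morph (fun c => (b : B) *: gamma c) : c d / c + d}.
    by move=> d d'; rewrite gammaD; exact: (@scalerDr _ D).
  rewrite [RHS]gp -[in RHS]sumc.
  rewrite (big_morph _ scale_gamma (additive0 scale_gamma)).
  by apply: eq_bigr => i _; rewrite lcontr_rpush // bract1.
have wD i : (fun n => pairing (w i) n (y + z))
    = ((fun n => pairing (w i) n y) : MB -> B) + (fun n => pairing (w i) n z).
  by apply: funext => n; exact: bD.
have hD i : {morph (fun f : MB -> B => lcontr f (rpush 1 (rcoact (e i)))) :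
    f g / f + g} by move=> f g; exact: lcontr_formD.
have [r cr sumr] := covers_add hD cs ct; exists r.
  by split=> [|i ri]; [exact: cr.1 | rewrite wD; exact: cr.2].
transitivity (gamma_tilde phi y + gamma_tilde phi z); last exact: esym (gD _ _).
rewrite -sumy -sumz -[RHS]sumr.
by apply: eq_bigr => i _; rewrite wD.
Qed.

(** The components of the new section are the composites of [sigma] with the
    maps [B (x)_A C -> (M (x)_A B)^*] induced by the [w i]. *)
Lemma left_section_base_change :
  left_section (M := ind_rcomod phi M)
    (fun i => tpure M Bm (e i) (1 : B))
    (fun i d n => pairing (w i) n (sigma d)).
Proof.
have [sl sc] := sigma_colinear.
split=> [i d|i n|i d n|d].
- exact: pairing_rlinear.
- move=> b d d'; rewrite sl; exact: pairing_llinear.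
- have iD : linear (@idfun (rmod D)) by [].
  have w_colinear c m :
      rcontr (M := rmod C) ((w i)^~ m) (delta c) = lcontr (w i c) (rcoact m).
    by case: sec.
  rewrite -[RHS](pairing_colinear (wrl i) (wll i) w_colinear).
  rewrite -[ind_lcoact _]/(lcoact (sigma d)) sc.
  rewrite -[@lcoact _ _ _ (lcoring D) d]/(delta d).
  have bl : linear (pairing (w i) n : BC -> B^o) by exact: pairing_llinear.
  have bsl : linear ((fun d => pairing (w i) n (sigma d)) : D -> B^o).
    by move=> b c c'; rewrite sl bl.
  elim/tensor_ind: (delta d) => [d1 d2|x y IHx IHy].
    by rewrite (tmap_pure iD sl) !rcontr_pure.
  by rewrite (tmapD iD sl) !rcontrD // IHx IHy.
have [s cs sums] := pairing_sum (sigma d); exists s => //.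
rewrite -[RHS](sigmaK d) -sums; apply: eq_bigr => i _.
by rewrite -ind_rcoact_pure.
Qed.

End SectionBaseChange.
End InducedCoactions.
End CoringBaseChange.

Theorem theorem5p4 (k : comPzRingType) (A B : kalgebra k)
    (C : coring A) (D : coring B) (phi : coring_mor C D) (M : rcomod C)
    (gamma_split : lsplit_epi (gamma_tilde phi
                     : ind_lcomod phi (lcoring C) -> lcoring D))
    (M_principal : principal M)
    (M_fflat : faithfully_flat (kmod M))
    (D_flat : flat D)
    (BC_coflat : coflat (ind_lcomod phi (lcoring C))) :
  principal (ind_rcomod phi M).
Proof.
have [_ [sigma [sigma_colinear sigmaK]]] := gamma_split.
have [w sec] := left_section_of_principal M_principal.
have [[fgM projM _] _] := M_principal.
have [s [xi xib]] := fg_projective_dual_basis fgM projM.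
have sec' := left_section_base_change sigma_colinear sigmaK sec.
apply: principal_of_left_section sec'.
  exact: base_change_fg xib.
exact: base_change_projective xib.
Qed.
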